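(* Let $\alpha$ be a totally real algebraic integer. Then, as $n\to\infty$, the multiplicity $N_\alpha(\mathcal{R}_n)$ of $\alpha$ as an eigenvalue of the random recursive tree $\mathcal{R}_n$ with $n$ vertices has mean and variance satisfying \[\frac{\mathbb{E}(N_\alpha(\mathcal{R}_n))}{n}\to \mu_{\mathrm{rec},\alpha}\quad\text{and}\quad \frac{\mathbb{V}(N_\alpha(\mathcal{R}_n))}{n}\to\sigma^2_{\mathrm{rec},\alpha},\] where the limits $\mu_{\mathrm{rec},\alpha}$ and $\sigma^2_{\mathrm{rec},\alpha}$ are finite and satisfy $\mu_{\mathrm{rec},\alpha}>0$ and $\sigma^2_{\mathrm{rec},\alpha}>0$.
   Context: A totally real algebraic integer is a real number that is a zero of a monic polynomial with integer coefficients all of whose complex zeros are real. (It is known, by a theorem of Salez, that a real number is an eigenvalue of the adjacency matrix of some finite tree if and only if it is a totally real algebraic integer.) A recursive tree with $n$ vertices is a rooted (unordered) tree with vertex labels $1,\dots,n$, each used once, whose labels increase along every path starting at the root. There are $(n-1)!$ of them, and the random recursive tree $\mathcal{R}_n$ is uniformly distributed among them. Eigenvalues of a tree are the eigenvalues of the adjacency matrix of the underlying undirected graph; $N_\alpha(T)$ is the multiplicity of $\alpha$ as an eigenvalue of $T$ ($0$ if $\alpha$ is not an eigenvalue). $\mathbb{E}$ and $\mathbb{V}$ denote expectation and variance. *)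

(* Defs.v *)
From HB Require Import structures.
From mathcomp Require Import all_boot all_order all_algebra.
From mathcomp Require Import complex.
From mathcomp Require Import all_classical all_reals all_analysis.

Set Implicit Arguments.
Unset Strict Implicit.
Unset Printing Implicit Defensive.

Import Order.TTheory GRing.Theory Num.Theory.
Import numFieldNormedType.Exports.

Local Open Scope ring_scope.
Local Open Scope classical_set_scope.

Definition totally_real_algebraic_integer (R : realType) (alpha : R) : Prop :=
  exists p : {poly int},
    [/\ p \is monic,
        root (map_poly (intr : int -> R) p) alpha &
        forall z : complex R,
          root (map_poly (intr : int -> complex R) p) z -> z \is Num.real].

(* Cycles of length at most 2 are not graph cycles: [:: x; y] only walks back
   and forth along one edge. *)
Definition is_tree (T : finType) (e : rel T) : Prop :=
  [/\ symmetric e,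
      irreflexive e,
      (forall x y : T, connect e x y) &
      (forall c : seq T, ucycle e c -> (size c <= 2)%N)].

(* The vertices are their own labels; the labels 1, ..., n are shifted to
   0, ..., n - 1, the values of 'I_n. Paths in a graph do not repeat vertices,
   hence the uniqueness assumption. *)
Definition is_recursive_tree (n : nat) (r : 'I_n) (e : rel 'I_n) : Prop :=
  is_tree e /\
  (forall p : seq 'I_n, path e r p -> uniq (r :: p) ->
     sorted ltn [seq val i | i <- r :: p]).

(* A rooted tree with vertex set 'I_n: its root, and its adjacency relation as
   a set of ordered pairs. Having no order on the children, it is unordered. *)
Definition rooted_graph (n : nat) : finType :=
  ('I_n * {set 'I_n * 'I_n})%type.

Definition adj (n : nat) (t : rooted_graph n) : rel 'I_n :=
  [rel i j | (i, j) \in t.2].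

Definition recursive_trees (n : nat) : {set rooted_graph n} :=
  [set t : rooted_graph n | `[< is_recursive_tree t.1 (adj t) >]]%SET.

Definition adjacency_mx (R : realType) (n : nat) (t : rooted_graph n) :
    'M[R]_n :=
  \matrix_(i < n, j < n) (adj t i j)%:R.

(* The adjacency matrix of a tree is real symmetric, so the dimension of the
   eigenspace is also the multiplicity as a root of the characteristic
   polynomial. *)
Definition eigen_mult (R : realType) (alpha : R) (n : nat)
    (t : rooted_graph n) : nat :=
  \rank (eigenspace (adjacency_mx R t) alpha).

Definition unif_mean (R : realType) (T : finType) (A : {set T}) (X : T -> R) :
    R :=
  (\sum_(t in A) X t) / #|A|%:R.

Definition unif_var (R : realType) (T : finType) (A : {set T}) (X : T -> R) :
    R :=
  unif_mean A (fun t => (X t - unif_mean A X) ^+ 2).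

Definition mean_mult_rec (R : realType) (alpha : R) (n : nat) : R :=
  unif_mean (recursive_trees n) (fun t => (eigen_mult alpha t)%:R).

Definition var_mult_rec (R : realType) (alpha : R) (n : nat) : R :=
  unif_var (recursive_trees n) (fun t => (eigen_mult alpha t)%:R).

(* Main.v *)
Require Import Defs.
From HB Require Import structures.
From mathcomp Require Import all_boot all_order all_algebra.
From mathcomp Require Import complex.
From mathcomp Require Import all_classical all_reals all_analysis.
From mathcomp Require Import separable ring lra zify.
From mathcomp Require polyorder.

Set Implicit Arguments.
Unset Strict Implicit.
Unset Printing Implicit Defensive.

Import Order.TTheory GRing.Theory Num.Theory.
Import numFieldNormedType.Exports.

Local Open Scope ring_scope.
Local Open Scope classical_set_scope.

(** Every totally real algebraic integer [alpha] is an eigenvalue of a tree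
    (Salez): if the eigenvalue equation holds on a rooted tree except at the root,
    where the vector is [1], and [b] is the sum of its values at the children of
    the root, then grafting the tree below a new vertex adds [1 / (alpha - b)] to
    the sum at that vertex, and we have to reach the sum [alpha]. Divided by
    [alpha], with [theta = 1 / alpha ^ 2], the sums that can be added form a
    set [F] closed under addition and [x |-> theta / (1 - x)]; suppose that [1] is
    not in [F]. Among the elements of [F] are rational functions of [alpha ^ 2]
    with a simple pole just to the left of any prescribed conjugate of
    [alpha ^ 2], so a positive rational combination of them equals [1] and [F]
    contains a positive integer. This forces all [+- theta ^ k] into [F], and
    integrality of [alpha ^ 2] gives [1] in [F].

    A random recursive tree splits at the edge from the root to its oldest child
    into two independent recursive trees, with uniform sizes. Removing an edge
    changes the multiplicity by at most [2], so mean and centred second moment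
    satisfy [x_k = 2/k (x_0 + ... + x_(k-1)) + b_k] with a small [b_k], whose
    solution is linear in [k]. The mean is at least that of the number of copies
    of a fringe tree carrying an eigenvector that vanishes at its root. For the
    variance, take two trees [s1], [s2] with the same number of vertices and
    different multiplicities such that exchanging them always changes the
    multiplicity by the same amount: the difference [Z] of suitably weighted
    numbers of copies of [s1] and [s2] has a covariance with the multiplicity and
    a variance which are both linear in [k], and Cauchy-Schwarz concludes. *)

(** * Salez: sets closed under [x |-> theta / (1 - x)] *)

Definition salez_closed (R : realFieldType) (theta : R) (F : R -> Prop) : Prop :=
  [/\ F 0, (forall x y, F x -> F y -> F (x + y)) &
      forall x, F x -> x != 1 -> F (theta / (1 - x))].

Section SalezClosed.
Variables (R : realFieldType) (theta : R) (F : R -> Prop).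
Hypotheses (Fcl : salez_closed theta F) (F1 : ~ F 1).

Let F0 : F 0. Proof. by case: Fcl. Qed.
Let FD x y : F x -> F y -> F (x + y).
Proof. by case: Fcl => _ H _; apply: H. Qed.

Lemma salez_closed_mulrn x n : F x -> F (x *+ n).
Proof.
by move=> Fx; elim: n => [|n IH]; rewrite ?mulr0n // mulrS; apply: FD.
Qed.

Lemma salez_closed_sum (I : Type) (r : seq I) (P : pred I) (f : I -> R) :
  (forall i, P i -> F (f i)) -> F (\sum_(i <- r | P i) f i).
Proof. by move=> Ff; apply: big_ind. Qed.

Lemma salez_closed_neq1 x : F x -> x != 1.
Proof. by move=> Fx; apply/eqP => x1; apply: F1; rewrite -x1. Qed.

Lemma salez_closed_sub_neq0 x : F x -> 1 - x != 0.
Proof. by move=> /salez_closed_neq1; rewrite subr_eq0 eq_sym. Qed.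

Lemma salez_closed_step x : F x -> F (theta / (1 - x)).
Proof.
by move=> Fx; case: Fcl => _ _; apply; rewrite // salez_closed_neq1.
Qed.

Section Powers.
Variable p : nat.
Hypotheses (p_gt0 : (0 < p)%N) (Fp : F p%:R).

Let p_gt1 : (1 < p)%N.
Proof. by case: p p_gt0 Fp => [//|[|//]] _ /F1. Qed.

Let Fadd_neq0 x : F x -> 1 + x != 0.
Proof.
move=> Fx; apply/eqP => x1; apply: F1.
(* If [x = -1], then [p + (p - 1) x = 1] would be in [F]. *)
have -> : 1 = p%:R + x *+ p.-1 :> R.
  rewrite -[x](addKr 1) x1 addr0 mulNrn -natrB; last by lia.
  by have -> : (p - p.-1 = 1)%N by lia.
by apply: FD => //; apply: salez_closed_mulrn.
Qed.

(** One step from [p + (p - 1) x] leads to [- theta / ((p - 1) (1 + x))], and adding [p - 1] copies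
    of it clears the factor [p - 1]. The integer [p] is what makes negative signs available. *)
Lemma salez_closed_opp_step x : F x -> F (- theta / (1 + x)).
Proof.
move=> Fx; have F2 : F (p%:R + x *+ p.-1).
  by apply: FD => //; apply: salez_closed_mulrn.
have := salez_closed_mulrn p.-1 (salez_closed_step F2).
suff -> : theta / (1 - (p%:R + x *+ p.-1)) *+ p.-1 = - theta / (1 + x) by [].
have q0 : p.-1%:R != 0 :> R by rewrite pnatr_eq0; lia.
have -> : p%:R = 1 + p.-1%:R :> R by rewrite -(natrD _ 1%N); congr _%:R; lia.
have -> : 1 - (1 + p.-1%:R + x *+ p.-1) = - (p.-1%:R * (1 + x)).
  by rewrite -mulr_natr; ring.
rewrite -mulr_natr; field; rewrite q0 andbT; apply: Fadd_neq0 => //.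
Qed.

(* For [y = x - theta ^+ k.+1], one step from [theta ^+ k.+1 / (1 - y)] leads to
   [theta + theta ^+ k.+2 / (1 - x)]. *)
Lemma salez_closed_powers k :
  [/\ F (theta ^+ k.+1), F (- theta ^+ k.+1),
      (forall x, F x -> F (theta ^+ k.+1 / (1 - x))) &
      (forall x, F x -> F (- theta ^+ k.+1 / (1 + x)))].
Proof.
have Fth : F theta.
  by have := salez_closed_step F0; rewrite subr0 divr1.
have FNth : F (- theta) by have := salez_closed_opp_step F0; rewrite addr0 divr1.
have finish j : (forall x, F x -> F (theta ^+ j / (1 - x))) ->
    (forall x, F x -> F (- theta ^+ j / (1 + x))) ->
    [/\ F (theta ^+ j), F (- theta ^+ j),
      (forall x, F x -> F (theta ^+ j / (1 - x))) &
      (forall x, F x -> F (- theta ^+ j / (1 + x)))].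
  move=> H1 H2; split=> //; first by have := H1 _ F0; rewrite subr0 divr1.
  by have := H2 _ F0; rewrite addr0 divr1.
elim: k => [|k [F1k FN1k Fk FNk]]; apply: finish => x Fx.
- exact: salez_closed_step.
- exact: salez_closed_opp_step.
- have Fy := FD Fx FN1k; have y0 := salez_closed_sub_neq0 Fy.
  have x0 := salez_closed_sub_neq0 Fx; have z0 := salez_closed_sub_neq0 (Fk _ Fy).
  have := FD FNth (salez_closed_step (Fk _ Fy)).
  suff -> : - theta + theta / (1 - theta ^+ k.+1 / (1 - (x - theta ^+ k.+1)))
    = theta ^+ k.+2 / (1 - x) by [].
  by rewrite [theta ^+ k.+2]exprS; field; rewrite x0 y0.
- have Fy := FD Fx F1k; have y0 := Fadd_neq0 Fy.
  have x0 := Fadd_neq0 Fx; have z0 := Fadd_neq0 (FNk _ Fy).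
  have := FD Fth (salez_closed_opp_step (FNk _ Fy)).
  suff -> : theta + - theta / (1 + - theta ^+ k.+1 / (1 + (x + theta ^+ k.+1)))
    = - theta ^+ k.+2 / (1 + x) by [].
  by rewrite [theta ^+ k.+2]exprS; field; rewrite x0 y0.
Qed.

Lemma salez_closed_mulrz_power k (z : int) : F (theta ^+ k.+1 *~ z).
Proof.
have [F1k FN1k _ _] := salez_closed_powers k.
case: z => n; first exact: salez_closed_mulrn.
by rewrite NegzE mulrNz -mulNrz; apply: salez_closed_mulrn.
Qed.

(** Multiplied by [theta ^ d], the monic equation of degree [d] for [theta^-1] writes [1] as an
    integer combination of positive powers of [theta], which all lie in [F]. *)
Lemma salez_closed_integral :
  theta != 0 -> integralOver (intr : int -> R) theta^-1 -> False.
Proof.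
move=> th0 [q mon_q /rootP]; rewrite horner_coef.
rewrite (size_map_poly_id0); last by rewrite (monicP mon_q) rmorph1 oner_neq0.
have q0 := monic_neq0 mon_q; have sq : (0 < size q)%N by rewrite size_poly_gt0.
case Eq: (size q) sq => [//|d] _; rewrite big_ord_recr /= => H; apply: F1.
have lq : q`_d = 1 by rewrite -(monicP mon_q) lead_coefE Eq.
move: H; rewrite coef_map /= lq rmorph1 mul1r => /eqP; rewrite addrC addr_eq0 => /eqP H.
have thd : theta ^+ d * theta^-1 ^+ d = 1 by rewrite exprVn divff // expf_neq0.
rewrite -thd H mulrN mulr_sumr -sumrN; apply: salez_closed_sum => i _.
rewrite coef_map /= -mulrN.
have -> : theta ^+ d * - ((q`_i)%:~R * theta^-1 ^+ i)
  = theta ^+ (d - i.+1).+1 *~ (- q`_i).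
  have {1}-> : d = ((d - i.+1).+1 + i)%N by have := ltn_ord i; lia.
  rewrite exprD -mulrzr mulrNz exprVn; field; exact: expf_neq0.
exact: salez_closed_mulrz_power.
Qed.
End Powers.
End SalezClosed.

(** Let [m] be the largest absolute value of an entry of [u]. Every entry is within
    [d m eps <= m / 4] of [b], so [m <= 4 b / 3] and the distance is at most [b / 3]. The case
    [b = 0] gives the injectivity of [M]. *)
Lemma near_id_sol_close (R : realFieldType) d (eps : R) (M : 'M[R]_d) (b : R)
    (u : 'rV[R]_d) :
  (forall i j, `|M i j - (i == j)%:R| <= eps) -> d%:R * eps <= 4^-1 -> 0 <= b ->
  u *m M = const_mx b -> forall j, `|u 0 j - b| <= b / 2.
Proof.
move=> HM Hd b0 uM j.
have [jm _ Hjm] : {jm | predT jm & forall i, predT i -> `|u 0 i| <= `|u 0 jm|}.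
  by case: (Order.TotalTheory.arg_maxP (fun i => `|u 0 i|) (isT : predT j)) => jm _ H;
     exists jm.
set m := `|u 0 jm| in Hjm.
have eps0 : 0 <= eps by apply: le_trans (HM j j).
have dist i : `|u 0 i - b| <= m / 4.
  have := congr1 (fun v : 'rV_d => v 0 i) uM; rewrite !mxE => <-.
  have -> : u 0 i - \sum_k u 0 k * M k i = - \sum_k u 0 k * (M k i - (k == i)%:R).
    have {1}-> : u 0 i = \sum_k u 0 k * (k == i)%:R.
      by rewrite (bigD1 i) //= eqxx mulr1 big1 ?addr0 // => k /negPf->; rewrite mulr0.
    by rewrite -sumrB -sumrN; apply: eq_bigr => k _; ring.
  rewrite normrN; apply: le_trans (ler_norm_sum _ _ _) _.
  apply: le_trans (_ : \sum_(k < d) m * eps <= _).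
    by apply: ler_sum => k _; rewrite normrM ler_pM // Hjm.
  rewrite sumr_const card_ord -[_ *+ d]mulr_natl.
  have m0 : 0 <= m by exact: normr_ge0.
  by rewrite mulrCA ler_wpM2l.
have m_le : m <= b + m / 4.
  have := dist jm; have := ler_normD (u 0 jm - b) b.
  by rewrite subrK -/m (ger0_norm b0) => ??; lra.
by apply: le_trans (dist j) _; lra.
Qed.

Lemma near_id_unit (R : realFieldType) d (eps : R) (M : 'M[R]_d) :
  (forall i j, `|M i j - (i == j)%:R| <= eps) -> d%:R * eps <= 4^-1 ->
  M \in unitmx.
Proof.
move=> HM Hd; rewrite -row_free_unit -kermx_eq0; apply/eqP/row_matrixP => i.
rewrite row0; apply/rowP => j; rewrite [in RHS]mxE.
have uM : row i (kermx M) *m M = const_mx 0.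
  by rewrite -row_mul mulmx_ker row0; apply/rowP => k; rewrite !mxE.
have := near_id_sol_close HM Hd (lexx 0) uM j.
by rewrite subr0 mul0r normr_le0 => /eqP.
Qed.

Lemma common_denominator d (w : 'I_d -> rat) : (forall j, 0 < w j) ->
  exists D : nat, (0 < D)%N /\ exists a : 'I_d -> nat, forall j, w j * D%:R = (a j)%:R.
Proof.
move=> wpos.
exists (\prod_j `|denq (w j)|)%N; split.
  by rewrite prodn_gt0 // => j; rewrite absz_gt0 denq_eq0.
exists (fun j => `|numq (w j)| * \prod_(i | i != j) `|denq (w i)|)%N => j.
rewrite (bigD1 j) //= !natrM mulrA; congr (_ * _).
rewrite -{1}(divq_num_den (w j)).
have numE : `|numq (w j)|%N%:R = (numq (w j))%:~R :> rat.
  by rewrite -[in RHS](gez0_abs (_ : 0 <= numq (w j))) // numq_ge0 ltW.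
have denE : `|denq (w j)|%N%:R = (denq (w j))%:~R :> rat.
  by rewrite -[in RHS](gez0_abs (_ : 0 <= denq (w j))) // ltW // denq_gt0.
by rewrite numE denE mulfVK // intr_eq0 denq_eq0.
Qed.

(* [c * f_j] approximates the j-th idempotent of [Q[x]/P] at each root of [P]:
   the coefficients expressing [1] in terms of the [f_j] are rational by
   uniqueness and positive by diagonal dominance. *)
Lemma positive_combination (R : realFieldType) (P : {poly rat}) d (ts : 'I_d -> R)
    (i0 : 'I_d) (A B : 'I_d -> {poly rat}) (c : 'I_d -> R) (eps : R) :
  size P = d.+1 -> (forall i, root (map_poly ratr P) (ts i)) ->
  (forall j, coprimep P (B j)) -> (forall j, 0 < c j) -> d%:R * eps <= 4^-1 ->
  (forall j i, `|c j * ((map_poly ratr (A j)).[ts i] / (map_poly ratr (B j)).[ts i])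
                 - (j == i)%:R| <= eps) ->
  exists D : nat, (0 < D)%N /\ exists a : 'I_d -> nat,
    \sum_j (a j)%:R * ((map_poly ratr (A j)).[ts i0] / (map_poly ratr (B j)).[ts i0])
     = D%:R :> R.
Proof.
move=> sP rP cop cpos Hd Happ.
pose ev (q : {poly rat}) i : R := (map_poly ratr q).[ts i].
have evM p q i : ev (p * q) i = ev p i * ev q i by rewrite /ev rmorphM /= hornerM.
have evD p q i : ev (p + q) i = ev p i + ev q i by rewrite /ev rmorphD /= hornerD.
have evP i : ev P i = 0 by apply/rootP.
have P0 : P != 0 by rewrite -size_poly_gt0 sP.
(* By Bezout, [B j] is invertible modulo [P], so a rational polynomial of degree less than [d] takes
   the values of [A j / B j] at all the roots. *)
have [r Hr] : exists r : 'I_d -> {poly rat}, forall j,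
    (size (r j) <= d)%N /\ forall i, ev (r j) i = ev (A j) i / ev (B j) i.
  have H j : {r : {poly rat} | (size r <= d)%N /\ forall i, ev r i = ev (A j) i / ev (B j) i}.
    have [[u v] /= uv] := sig_eqW (Bezout_eq1_coprimepP _ _ (cop j)).
    exists ((A j * v) %% P); split; first by rewrite -ltnS -sP ltn_modp.
    move=> i; have Hv : ev v i * ev (B j) i = 1.
      by have := congr1 (ev^~ i) uv; rewrite evD !evM evP mulr0 add0r /ev rmorph1 hornerC.
    have B0 : ev (B j) i != 0.
      by apply/eqP => B0; move/eqP: Hv; rewrite B0 mulr0 eq_sym oner_eq0.
    have := congr1 (ev^~ i) (divp_eq (A j * v) P).
    rewrite evD !evM evP mulr0 add0r => <-.
    by apply: (mulIf B0); rewrite divfK // -mulrA Hv mulr1.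
  by exists (fun j => sval (H j)) => j; case: (H j).
pose G := \matrix_(j, i) (ev (A j) i / ev (B j) i) : 'M[R]_d.
pose M := diag_mx (\row_j c j) *m G.
have ME j i : M j i = c j * (ev (A j) i / ev (B j) i).
  by rewrite /M mul_diag_mx !mxE.
have HM j i : `|M j i - (j == i)%:R| <= eps by rewrite ME; apply: Happ.
have uM := near_id_unit HM Hd.
(* [G] is the coefficient matrix [Q] of the [r j] times the Vandermonde matrix [V]. Hence [Q] is
   invertible over the rationals, and [w] holds the coordinates of the constant polynomial [1] in
   terms of the [r j]. *)
pose Q := \matrix_(j, k) (r j)`_k : 'M[rat]_d.
pose V := \matrix_(k < d, i < d) ts i ^+ k : 'M[R]_d.
have GE : map_mx ratr Q *m V = G.
  apply/matrixP => j i; rewrite !mxE; have [sr <-] := Hr j; rewrite /ev.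
  rewrite (@horner_coef_wide _ d) ?size_map_poly //.
  by apply: eq_bigr => k _; rewrite !mxE coef_map.
have : M \in unitmx by [].
rewrite unitmx_mul => /andP[_]; rewrite -GE unitmx_mul map_unitmx => /andP[uQ uV].
pose e : 'rV[rat]_d := \row_k (k == 0%N :> nat)%:R.
pose w := e *m invmx Q.
have wG : map_mx ratr w *m G = const_mx 1.
  rewrite -GE mulmxA -map_mxM /w mulmxKV //; apply/rowP => i; rewrite !mxE.
  have d0 : (0 < d)%N := leq_ltn_trans (leq0n i0) (ltn_ord i0).
  rewrite (bigD1 (Ordinal d0)) //= !mxE /= rmorph1 mul1r expr0 big1 ?addr0 // => k k0.
  have /negPf E : (k != 0%N :> nat) by [].
  by rewrite !mxE E rmorph0 mul0r.
pose u : 'rV[R]_d := \row_j (ratr (w 0 j) / c j).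
have uMb : u *m M = const_mx 1.
  rewrite -wG /M mulmxA; congr (_ *m _); apply/rowP => j.
  rewrite mul_mx_diag !mxE divfK //; exact: lt0r_neq0.
have wpos j : 0 < w 0 j.
  (* The entries of [u] are within [1 / 2] of [1], hence positive. *)
  have := near_id_sol_close HM Hd ler01 uMb j; rewrite ler_norml mxE => /andP[+ _].
  move=> H; have : 0 < (ratr (w 0 j) / c j : R) by lra.
  by rewrite pmulr_lgt0 ?invr_gt0 // ltr0q.
have [D [D0 [a Ha]]] := common_denominator wpos.
exists D; split; first exact: D0.
exists a.
have := congr1 (fun v : 'rV_d => v 0 i0) wG; rewrite [LHS]mxE [RHS]mxE => H.
rewrite -[RHS]mul1r -[X in _ = X * _]H mulr_suml; apply: eq_bigr => j _.
have := congr1 (ratr : rat -> R) (Ha j); rewrite rmorphM /= !rmorph_nat => <-.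
by rewrite mulrAC [map_mx _ w 0 j]mxE [G j i0]mxE.
Qed.

(** As [q] tends to [ts j] from the left, the quotient is [1] for [i = j] and tends to [0] for the
    other [i]. A rational [q] close enough is then chosen, positive so that it is a quotient of
    natural numbers. *)
Lemma left_pole_approx (R : realType) d (ts : 'I_d -> R) (j : 'I_d) (eps : R) :
  injective ts -> 0 < ts j -> 0 < eps ->
  exists N s : nat, let q := N%:R / s.+1%:R in
   q < ts j /\ forall i, ts i - q != 0 /\
     `|(ts j - q) / (ts i - q) - (j == i)%:R| <= eps.
Proof.
move=> tsI tj0 eps0.
have H : \forall q \near (ts j)^'-, forall i, ts i - q != 0 /\
     `|(ts j - q) / (ts i - q) - (j == i)%:R| <= eps.
  apply: filter_forall => i; have [<-|ji] := eqVneq j i.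
    near=> q; have qt : q < ts j by near: q; exact: nbhs_left_lt.
    have q0 : ts j - q != 0 by rewrite subr_eq0 gt_eqF.
    by split=> //; rewrite divff // subrr normr0 ltW.
  have ij0 : ts i - ts j != 0 by rewrite subr_eq0 (inj_eq tsI) eq_sym.
  have c1 (x : R) : (fun q => x - q) @ ts j --> x - ts j.
    by apply: cvgB; [exact: cvg_cst|exact: cvg_id].
  have c2 : (fun q => (ts j - q) / (ts i - q)) @ ts j --> 0.
    rewrite -[0](mul0r (ts i - ts j)^-1) -(subrr (ts j)).
    by apply: cvgM; [exact: c1|apply: cvgV => //; exact: c1].
  suff W : \forall q \near ts j, ts i - q != 0 /\
     `|(ts j - q) / (ts i - q) - 0| <= eps by apply: cvg_within; exact: W.
  near=> q; split.
    near: q; apply: (cvgr_neq0 _ (c1 (ts i))) => //.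
  by rewrite distrC; near: q; apply: cvgr_dist_le.
have [e /= e0 He] := H.
have lt0 : Num.max 0 (ts j - e) < ts j by rewrite gt_max tj0 ltrBlDr ltrDl.
have [q] := rat_in_itvoo lt0.
rewrite in_itv /= gt_max => /andP[/andP[q0 qe] qt].
have dq := denq_gt0 q; have nq : 0 < numq q by rewrite numq_gt0 -(ltr0q R).
exists `|numq q|%N, (`|denq q|.-1)%N => /=.
have -> : (`|numq q|%N%:R / (`|denq q|.-1).+1%:R : R) = ratr q.
  rewrite prednK ?absz_gt0 ?denq_eq0 // /ratr; congr (_ / _).
    by rewrite -[in RHS](gez0_abs (ltW nq)).
  by rewrite -[in RHS](gez0_abs (ltW dq)).
split=> //; apply: (He (ratr q)) => //=.
rewrite gtr0_norm ?subr_gt0 //; lra.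
Unshelve. all: by end_near. Qed.

(* As [m] grows, [(x - m) / ((x - N) (x - m) - s m x)] tends to
   [1 / ((1 + s) x - N)], whose pole [N / (1 + s)] is placed just to the left of
   [ts j]. *)
Lemma pole_approx (R : realType) d (ts : 'I_d -> R) (j : 'I_d) (eps : R) :
  injective ts -> (forall i, 0 < ts i) -> 0 < eps ->
  exists N s m : nat, exists2 c : R, 0 < c & forall i,
    `|c * ((ts i - m%:R) / ((ts i - N%:R) * (ts i - m%:R) - (s * m)%:R * ts i))
       - (j == i)%:R| <= eps.
Proof.
move=> tsI tpos eps0.
have eps20 : 0 < eps / 2 by lra.
have [N [s /= [qt Hq]]] := left_pole_approx tsI (tpos j) eps20.
set q := _ / _ in qt Hq.
have H : \forall m \near \oo, forall i,
  `|(ts j - q) / (ts i - q) - (ts j - q) * (1 - harmonic m * ts i) /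
       (ts i - q - harmonic m * (ts i * (ts i - N%:R) / s.+1%:R))| <= eps / 2.
  apply: filter_forall => i; apply: cvgr_dist_le => //.
  have [q0 _] := Hq i.
  have ch (x : R) : (fun m => harmonic m * x) @ \oo --> (0 : R).
    rewrite -(mul0r x); apply: cvgM; [exact: cvg_harmonic|exact: cvg_cst].
  have c1 (y x : R) : (fun m => y - harmonic m * x) @ \oo --> y.
    rewrite -[X in _ --> X]subr0; apply: cvgB; [exact: cvg_cst|exact: ch].
  apply: cvgM; last by apply: cvgV.
  rewrite -[X in _ --> X]mulr1; apply: cvgM; [exact: cvg_cst|exact: c1].
(* [harmonic m] is [1 / (m + 1)], whence [m.+1]; the factor [s + 1] comes from
   [(1 + s) x - N = (1 + s) (x - q)]. *)
have [m _ Hm] := H; exists N, s, m.+1, (s.+1%:R * (ts j - q)).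
  by rewrite mulr_gt0 ?subr_gt0.
move=> i; have [q0 H1] := Hq i.
have := Hm m (leqnn _) i; rewrite /harmonic /=.
set x := ts i in q0 H1 *.
have -> : s.+1%:R * (ts j - q) * ((x - m.+1%:R) / ((x - N%:R) * (x - m.+1%:R) - (s * m.+1)%:R * x))
  = (ts j - q) * (1 - m.+1%:R^-1 * x) / (x - q - m.+1%:R^-1 * (x * (x - N%:R) / s.+1%:R)).
  have s0 : s.+1%:R != 0 :> R by rewrite pnatr_eq0.
  have m0 : m.+1%:R != 0 :> R by rewrite pnatr_eq0.
  have -> : x - m.+1%:R = (1 - m.+1%:R^-1 * x) * - m.+1%:R by field.
  have -> : (x - N%:R) * ((1 - m.+1%:R^-1 * x) * - m.+1%:R) - (s * m.+1)%:R * x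
     = (x - q - m.+1%:R^-1 * (x * (x - N%:R) / s.+1%:R)) * (s.+1%:R * - m.+1%:R).
    by rewrite natrM /q -[s.+1]addn1 natrD; field; rewrite natr1 s0 nat1r.
  rewrite [in LHS]invfM; set v := (_ - _ - _)^-1; clearbody v; field.
  by rewrite !nat1r m0.
have E (a b c : R) : a - c = (b - c) - (b - a) by ring.
move=> H2; rewrite (E _ ((ts j - q) / (x - q))).
by apply: le_trans (ler_normB _ _) _; rewrite [leRHS]splitr lerD.
Unshelve. all: by end_near. Qed.

(** [P] is a nonzero polynomial of least degree vanishing at [x], made monic. Minimality, applied to
    the remainder of [q], to the derivative and to the quotient by a gcd, yields divisibility,
    separability and coprimality. *)
Lemma ratr_min_poly (L : numFieldType) (x : L) (q : {poly rat}) :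
  q != 0 -> root (map_poly ratr q) x ->
  exists P : {poly rat}, [/\ P \is monic, root (map_poly ratr P) x, P %| q,
    separable_poly P &
    forall r, (map_poly ratr r).[x] != 0 -> coprimep P r].
Proof.
pose ev (r : {poly rat}) := (map_poly ratr r).[x].
move=> q0 /rootP rq.
pose S n := `[< exists r : {poly rat}, [/\ r != 0, size r = n & ev r = 0] >].
have exS : exists n, S n by exists (size q); apply/asboolP; exists q.
have [n /asboolP[P [P0 sP evP]] nmin] := ex_minnP exS.
have lP : lead_coef P != 0 by rewrite lead_coef_eq0.
have Pmin (r : {poly rat}) : (size r < size P)%N -> ev r = 0 -> r = 0.
  move=> sr er; apply/eqP; apply: contraT => r0.
  have : S (size r) by apply/asboolP; exists r.
  by move/nmin; rewrite -sP leqNgt sr.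
have evM (r s : {poly rat}) : ev (r * s) = ev r * ev s by rewrite /ev rmorphM /= hornerM.
have evD (r s : {poly rat}) : ev (r + s) = ev r + ev s by rewrite /ev rmorphD /= hornerD.
have cop (r : {poly rat}) : ev r != 0 -> coprimep P r.
  move=> er; rewrite coprimep_def eqn_leq.
  have g0 : gcdp P r != 0 by rewrite gcdp_eq0 (negPf P0).
  rewrite size_poly_gt0 g0 andbT leqNgt; apply/negP => sg.
  have eg : ev (gcdp P r) != 0.
    apply: contraNneq er => eg; rewrite -/(ev r) -(divpK (dvdp_gcdr P r)) evM eg mulr0.
    exact: eqxx.
  have P1 : P %/ gcdp P r != 0 by rewrite dvdp_div_eq0 ?dvdp_gcdl.
  move/eqP: P1; apply; apply: Pmin.
    rewrite size_divp // -subn1 ltn_subrL subn_gt0 sg /=.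
    by rewrite size_poly_gt0.
  apply: (mulIf eg); rewrite mul0r -evM divpK ?dvdp_gcdl //.
exists ((lead_coef P)^-1 *: P); split.
- by rewrite monicE lead_coefZ mulVf.
- by apply/rootP; rewrite map_polyZ /= hornerZ -/(ev P) evP mulr0.
- rewrite dvdpZl ?invr_eq0 //; apply/eqP; apply: Pmin; first by rewrite ltn_modp.
  have := congr1 ev (divp_eq q P); rewrite evD evM evP mulr0 add0r => <-.
  exact: rq.
- rewrite separable_poly.unlock derivZ coprimepZl ?invr_eq0 // coprimepZr ?invr_eq0 //.
  apply: cop; apply: contra_eq_neq evP => eP.
  have dP : deriv P = 0 by apply: Pmin => //; apply: lt_size_deriv.
  have [c c0 ->] : exists2 c, c != 0 & P = c%:P.
    apply/size_poly1P; have := P0; rewrite -size_poly_gt0.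
    by have := polyorder.size_deriv P; rewrite dP size_poly0; case: (size P) => [|[]].
  by rewrite /ev map_polyC hornerC /= fmorph_eq0.
by move=> r er; rewrite coprimepZl ?invr_eq0 // cop.
Qed.

(** With [p(x) = E(x^2) + x O(x^2)], the product is a difference of squares. So the zeros of [q] are
    the squares of those of [p], which are nonnegative once the zeros of [p] are real. *)
Lemma horner_even_odd (K : comNzRingType) (p : {poly int}) (x : K) :
  let q := even_poly p ^+ 2 - 'X * odd_poly p ^+ 2 in
  (map_poly intr q).[x ^+ 2] = (map_poly intr p).[x] * (map_poly intr p).[- x].
Proof.
move=> q; pose ev (r : {poly int}) (y : K) := (map_poly intr r).[y].
have H y : ev p y = ev (even_poly p) (y ^+ 2) + ev (odd_poly p) (y ^+ 2) * y.
  rewrite /ev -{1}(poly_even_odd p) rmorphD rmorphM /= !map_comp_poly map_polyXn.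
  by rewrite map_polyX hornerD hornerM !horner_comp !hornerXn hornerX.
have -> : map_poly intr q = map_poly (intr : int -> K) (even_poly p) ^+ 2
    - 'X * map_poly intr (odd_poly p) ^+ 2.
  by rewrite /q rmorphB /= rmorphXn [map_poly _ (_ * _)]rmorphM /= map_polyX rmorphXn.
rewrite -/(ev p _) -/(ev p _) !H sqrrN hornerD hornerN horner_exp.
rewrite [('X * _).[_]]hornerM hornerX horner_exp.
by rewrite -/(ev _ _) -/(ev (odd_poly p) _); ring.
Qed.

(** At [X^2] this polynomial is [p(X) p(-X)], and [X |-> -X] is an involution. *)
Lemma even_odd_neq0 (p : {poly int}) :
  p != 0 -> even_poly p ^+ 2 - 'X * odd_poly p ^+ 2 != 0.
Proof.
move=> p0; apply: contraNneq p0 => q0.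
have : (even_poly p ^+ 2 - 'X * odd_poly p ^+ 2) \Po 'X^2 = p * (p \Po (- 'X)).
  have := poly_even_odd p; set E := even_poly p; set O := odd_poly p; move=> <-.
  clearbody E O.
  have : 'X^2 \Po (- 'X : {poly int}) = 'X^2 by rewrite comp_Xn_poly sqrrN.
  have : 'X^2 = 'X * 'X :> {poly int} by [].
  move: ('X^2 : {poly int}) => Y YX X2.
  rewrite comp_polyB !expr2 !comp_polyM comp_polyX comp_polyD !comp_polyM.
  by rewrite -!comp_polyA X2 comp_polyX; move: (E \Po Y) (O \Po Y) => e o; rewrite YX; ring.
rewrite q0 comp_poly0 => /esym/eqP; rewrite mulf_eq0 => /orP[//|/eqP H].
have := congr1 (fun r => r \Po (- 'X)) H.
rewrite -comp_polyA comp_poly0 rmorphN /= comp_polyX opprK comp_polyXr => ->.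
exact: eqxx.
Qed.

Lemma map_poly_ratr_intr (K : numFieldType) (q : {poly int}) :
  map_poly (ratr : rat -> K) (map_poly intr q) = map_poly intr q.
Proof. by rewrite -map_poly_comp; apply: eq_map_poly => z /=; rewrite ratr_int. Qed.

(** [P] is the minimal polynomial of [alpha ^ 2]. Its complex roots are squares of roots of [p],
    which are real, so it splits over [R] with distinct nonnegative roots; [0] is excluded because
    [alpha] is not [0]. *)
Lemma totally_positive_square (R : realType) (alpha : R) (p : {poly int}) :
  p != 0 -> root (map_poly intr p) alpha -> alpha != 0 ->
  (forall z : complex R, root (map_poly intr p) z -> z \is Num.real) ->
  exists (P : {poly rat}) (d : nat) (ts : 'I_d -> R) (i0 : 'I_d),
   [/\ [/\ size P = d.+1, injective ts & (forall i, 0 < ts i)],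
       (forall i, root (map_poly ratr P) (ts i)), ts i0 = alpha ^+ 2 &
       forall r, (map_poly ratr r).[alpha ^+ 2] != 0 -> coprimep P r].
Proof.
move=> p0 /rootP rp a0 realp.
pose q := even_poly p ^+ 2 - 'X * odd_poly p ^+ 2.
have q0 : q != 0 by apply: even_odd_neq0.
have qa : root (map_poly ratr (map_poly intr q)) (alpha ^+ 2).
  by rewrite map_poly_ratr_intr; apply/rootP; rewrite horner_even_odd rp mul0r.
have qq0 : map_poly intr q != 0 :> {poly rat}.
  by rewrite map_poly_eq0_id0 // ?rmorph_eq0 // intr_eq0 lead_coef_eq0.
have [P [mP rP Pq sP cP]] := ratr_min_poly qq0 qa.
pose C := complex R.
have rootq (z : C) : root (map_poly ratr P) z -> 0 <= z.
  move=> rz; have : root (map_poly ratr (map_poly intr q)) z.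
    by apply: root_dvdp rz; rewrite dvdp_map.
  rewrite map_poly_ratr_intr -[z]sqrtCK => /rootP; rewrite horner_even_odd.
  move/eqP; rewrite mulf_eq0 => /orP[] zr; have := realp _ zr; rewrite ?realN => H;
  exact: real_exprn_even_ge0.
have [zs Ezs] := closed_field_poly_normal (map_poly ratr P : {poly C}).
have rz z : z \in zs -> root (map_poly ratr P) z.
  by rewrite -root_prod_XsubC -(rootZ _ _ (oner_neq0 C)) Ezs lead_coef_map (monicP mP) rmorph1.
pose ts := [seq complex.Re z | z <- zs].
have PR : map_poly ratr P = \prod_(t <- ts) ('X - t%:P) :> {poly R}.
  apply: (map_poly_inj (real_complex R)).
  rewrite -map_poly_comp rmorph_prod /= big_map.
  transitivity (map_poly ratr P : {poly C}).
    by apply: eq_map_poly => x /=; rewrite fmorph_rat.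
  rewrite Ezs lead_coef_map (monicP mP) rmorph1 scale1r.
  apply: eq_big_seq => z /rz/rootq z0.
  rewrite map_polyXsubC; congr ('X - _%:P); exact/esym/RRe_real/ger0_real.
pose tst := in_tuple ts.
have tsE i : root (map_poly ratr P) (tnth tst i).
  by rewrite PR root_prod_XsubC mem_tnth.
have tsI : uniq ts by rewrite -separable_prod_XsubC -PR separable_map.
have : alpha ^+ 2 \in ts by rewrite -root_prod_XsubC -PR.
case/(@tnthP _ _ tst) => i0 Ei0.
exists P, (size ts), (tnth tst), i0; split=> //; split=> //.
- by rewrite -(size_map_poly (ratr : rat -> R)) PR size_prod_XsubC.
- by move=> i j; apply: tuple_uniqP.
- move=> i; rewrite lt_neqAle eq_sym; apply/andP; split.
    apply: contraTneq (tsE i) => ->.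
    have : coprimep P 'X by apply: cP; rewrite map_polyX hornerX expf_neq0.
    rewrite -(coprimep_map (ratr : rat -> R)) => /coprimep_root H.
    by apply/negP => /H; rewrite map_polyX hornerX eqxx.
  have /mapP[z zin ->] := mem_tnth i tst.
  by have := rootq _ (rz _ zin); rewrite lecE => /andP[_].
Qed.

Lemma salez_closed_one (R : realType) (alpha : R) (F : R -> Prop) :
  totally_real_algebraic_integer alpha -> alpha != 0 ->
  salez_closed (alpha ^+ 2)^-1 F -> F 1.
Proof.
move=> [p [mp rp realp]] a0 Fcl; apply: contrapT => F1.
set tau := alpha ^+ 2 in Fcl *; set theta := tau^-1 in Fcl.
have tau0 : tau != 0 by rewrite expf_neq0.
have th0 : theta != 0 by rewrite invr_eq0.
have [P [d [ts [i0 [[sP tsI tspos] rP tsi0 cP]]]]] :=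
  totally_positive_square (monic_neq0 mp) rp a0 realp.
have d0 : 0 < d%:R :> R.
  by rewrite ltr0n; apply: leq_ltn_trans (ltn_ord i0).
pose eps : R := (4 * d%:R)^-1.
have eps0 : 0 < eps by rewrite invr_gt0 mulr_gt0.
have /choice[f Hf] : forall j, exists x : (nat * nat * nat * R), 0 < x.2 /\ forall i,
    `|x.2 * ((ts i - x.1.2%:R) / ((ts i - x.1.1.1%:R) * (ts i - x.1.2%:R)
        - (x.1.1.2 * x.1.2)%:R * ts i)) - (j == i)%:R| <= eps.
  move=> j; have [N [s [m [c c0 H]]]] := pole_approx j tsI tspos eps0.
  by exists (N, s, m, c).
pose m j := (f j).1.2; pose N j := (f j).1.1.1.
have [k kE] : {k | forall j, k j = ((f j).1.1.2 * m j)%N} by eexists.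
(* At [1 / theta], the quotient [A j / B j] equals [theta / (1 - arg j)] with [arg j = N theta + k
   theta / (1 - m theta)], built by the operations under which [F] is closed. It is the function of
   [pole_approx], with [k = s m]. *)
pose A j : {poly rat} := 'X - (m j)%:R%:P.
pose B j : {poly rat} := ('X - (N j)%:R%:P) * ('X - (m j)%:R%:P) - (k j)%:R%:P * 'X.
have evA j x : (map_poly ratr (A j)).[x] = x - (m j)%:R :> R.
  by rewrite /A map_polyXsubC /= hornerXsubC rmorph_nat.
have evB j x : (map_poly ratr (B j)).[x] = (x - (N j)%:R) * (x - (m j)%:R) - (k j)%:R * x :> R.
  rewrite /B rmorphB /= !rmorphM /= !map_polyXsubC map_polyX map_polyC /=.
  by rewrite hornerD hornerN !hornerM !hornerXsubC hornerC hornerX !rmorph_nat.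
have Fth : F theta.
  by have := salez_closed_step Fcl F1 (let: And3 h _ _ := Fcl in h); rewrite subr0 divr1.
have FD u v : F u -> F v -> F (u + v) by case: Fcl => _ H _; apply: H.
have H1 j : 1 - theta *+ m j != 0.
  by apply: (salez_closed_sub_neq0 F1); apply: (salez_closed_mulrn Fcl).
pose arg j := theta *+ N j + (theta / (1 - theta *+ m j)) *+ k j.
have Farg j : F (arg j).
  apply: FD; apply: (salez_closed_mulrn Fcl) => //.
  by apply: (salez_closed_step Fcl F1); apply: (salez_closed_mulrn Fcl).
have H2 j : 1 - arg j != 0 by apply: (salez_closed_sub_neq0 F1).
have thE : theta = tau^-1 by [].
have AE j : tau - (m j)%:R = tau * (1 - theta *+ m j).
  by rewrite -[theta *+ _]mulr_natr mulrBr mulr1 mulrA divff // mul1r.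
have BE j : (tau - (N j)%:R) * (tau - (m j)%:R) - (k j)%:R * tau
     = tau ^+ 2 * ((1 - theta *+ m j) * (1 - arg j)).
  have thh : (1 - theta *+ m j) * (theta / (1 - theta *+ m j)) = theta.
    by rewrite mulrCA divff ?mulr1.
  have E (h v x y : R) : tau ^+ 2 * (h * (1 - (theta * x + v * y)))
    = tau * h * (tau - tau * theta * x) - tau * (tau * (h * v)) * y by ring.
  rewrite /arg -[theta *+ N j]mulr_natr -[theta / _ *+ k j]mulr_natr E thh divff //.
  by rewrite mul1r mulr1 AE; ring.
have Bne j : (tau - (N j)%:R) * (tau - (m j)%:R) - (k j)%:R * tau != 0.
  by rewrite BE !mulf_neq0 // expf_neq0.
have [D [D0 [a Ha]]] : exists D : nat, (0 < D)%N /\ exists a : 'I_d -> nat,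
    \sum_j (a j)%:R * ((map_poly ratr (A j)).[ts i0] / (map_poly ratr (B j)).[ts i0])
     = D%:R :> R.
  apply: (@positive_combination R P d ts i0 A B (fun j => (f j).2) eps) => //.
  - by move=> j; apply: cP; rewrite evB; apply: Bne.
  - by move=> j; case: (Hf j).
  - by rewrite /eps invfM mulrCA divff ?mulr1 // lt0r_neq0.
  - by move=> j i; rewrite evA evB kE; case: (Hf j) => _; apply.
suff FD' : F D%:R.
  apply: (salez_closed_integral Fcl F1 D0 FD' th0).
  rewrite /theta invrK /tau expr2; apply: integral_mul;
  by exists p.
rewrite -Ha; apply: (salez_closed_sum Fcl) => j _.
rewrite evA evB tsi0 -/tau mulr_natl; apply: (salez_closed_mulrn Fcl).
rewrite BE AE.
have -> : tau * (1 - theta *+ m j) / (tau ^+ 2 * ((1 - theta *+ m j) * (1 - arg j)))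
  = theta / (1 - arg j).
  have E (t h w : R) : t != 0 -> h != 0 -> w != 0 ->
      t * h / (t ^+ 2 * (h * w)) = t^-1 / w.
    by move=> t0 h0 w0; field; rewrite t0 h0 w0.
  by rewrite E.
exact: (salez_closed_step Fcl F1).
Qed.

(** * Rooted trees and their eigenvectors *)

(** Used in both directions with mutually inverse index maps, this makes the rank invariant under
    renumbering. *)
Lemma mxrank_mxsub (K : fieldType) m n m' n' (f : 'I_m' -> 'I_m) (g : 'I_n' -> 'I_n)
  (A : 'M[K]_(m, n)) : (\rank (mxsub f g A) <= \rank A)%N.
Proof.
rewrite mxsubrc; apply: leq_trans (mxrankS (rowsub_sub _ _)) _.
rewrite -mxrank_tr -[X in (_ <= X)%N]mxrank_tr trmx_mxsub.
exact: mxrankS (rowsub_sub _ _).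
Qed.

(** * Rank of a three-block matrix under reordering of the blocks *)

Section BlockRank.
Variable K : fieldType.

Definition ord3A n1 n2 n3 (i : 'I_(n1 + (n2 + n3))) : 'I_(n1 + n2 + n3) :=
  match fintype.split i with
  | inl i => lshift n3 (lshift n2 i)
  | inr i => match fintype.split i with
             | inl i => lshift n3 (rshift n1 i)
             | inr i => rshift (n1 + n2) i end
  end.
Definition ord3Ai n1 n2 n3 (i : 'I_(n1 + n2 + n3)) : 'I_(n1 + (n2 + n3)) :=
  match fintype.split i with
  | inl i => match fintype.split i with
             | inl i => lshift (n2 + n3) i
             | inr i => rshift n1 (lshift n3 i) end
  | inr i => rshift n1 (rshift n2 i)
  end.
Definition ord3C n1 n2 n3 (i : 'I_(n2 + (n1 + n3))) : 'I_(n1 + n2 + n3) :=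
  match fintype.split i with
  | inl i => lshift n3 (rshift n1 i)
  | inr i => match fintype.split i with
             | inl i => lshift n3 (lshift n2 i)
             | inr i => rshift (n1 + n2) i end
  end.
Definition ord3Ci n1 n2 n3 (i : 'I_(n1 + n2 + n3)) : 'I_(n2 + (n1 + n3)) :=
  match fintype.split i with
  | inl i => match fintype.split i with
             | inl i => rshift n2 (lshift n3 i)
             | inr i => lshift (n1 + n3) i end
  | inr i => rshift n2 (rshift n1 i)
  end.

Variables (n1 n2 n3 : nat).
Variables (A : 'M[K]_n1) (B : 'M[K]_n2) (X : 'M[K]_n3).
Variables (E : 'M[K]_(n1, n2)) (F : 'M[K]_(n2, n1)) (U1 : 'M[K]_(n1, n3))
  (V1 : 'M[K]_(n3, n1)) (U2 : 'M[K]_(n2, n3)) (V2 : 'M[K]_(n3, n2)).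

Let spl m n (i : 'I_m) : fintype.split (lshift n i) = inl i.
Proof. exact: (unsplitK (inl _ i)). Qed.
Let spr m n (i : 'I_n) : fintype.split (rshift m i) = inr i.
Proof. exact: (unsplitK (inr _ i)). Qed.
Let simp := (row_mxEl, row_mxEr, col_mxEu, col_mxEd,
  block_mxEul, block_mxEur, block_mxEdl, block_mxEdr,
  spl, spr).

Lemma mxrank_block3A :
  \rank (block_mx (block_mx A E F B) (col_mx U1 U2) (row_mx V1 V2) X) =
  \rank (block_mx A (row_mx E U1) (col_mx F V1) (block_mx B U2 V2 X)).
Proof.
apply/eqP; rewrite eqn_leq; apply/andP; split.
  suff <- : mxsub (@ord3Ai n1 n2 n3) (@ord3Ai n1 n2 n3)
    (block_mx A (row_mx E U1) (col_mx F V1) (block_mx B U2 V2 X)) =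
    block_mx (block_mx A E F B) (col_mx U1 U2) (row_mx V1 V2) X by exact: mxrank_mxsub.
  apply/matrixP => i j; rewrite mxE.
  case: (split_ordP i) => {}i ->; case: (split_ordP j) => {}j ->;
    rewrite /ord3Ai !simp //.
  - case: (split_ordP i) => {}i ->; case: (split_ordP j) => {}j ->; by rewrite !simp.
  - case: (split_ordP i) => {}i ->; by rewrite !simp.
  - case: (split_ordP j) => {}j ->; by rewrite !simp.
suff <- : mxsub (@ord3A n1 n2 n3) (@ord3A n1 n2 n3)
    (block_mx (block_mx A E F B) (col_mx U1 U2) (row_mx V1 V2) X) =
    block_mx A (row_mx E U1) (col_mx F V1) (block_mx B U2 V2 X) by exact: mxrank_mxsub.
apply/matrixP => i j; rewrite mxE.
case: (split_ordP i) => {}i ->; case: (split_ordP j) => {}j ->;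
    rewrite /ord3A !simp //.
- case: (split_ordP j) => {}j ->; by rewrite !simp.
- case: (split_ordP i) => {}i ->; by rewrite !simp.
- case: (split_ordP i) => {}i ->; case: (split_ordP j) => {}j ->; by rewrite !simp.
Qed.

Lemma mxrank_block3C :
  \rank (block_mx (block_mx A E F B) (col_mx U1 U2) (row_mx V1 V2) X) =
  \rank (block_mx B (row_mx F U2) (col_mx E V2) (block_mx A U1 V1 X)).
Proof.
apply/eqP; rewrite eqn_leq; apply/andP; split.
  suff <- : mxsub (@ord3Ci n1 n2 n3) (@ord3Ci n1 n2 n3)
    (block_mx B (row_mx F U2) (col_mx E V2) (block_mx A U1 V1 X)) =
    block_mx (block_mx A E F B) (col_mx U1 U2) (row_mx V1 V2) X by exact: mxrank_mxsub.
  apply/matrixP => i j; rewrite mxE.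
  case: (split_ordP i) => {}i ->; case: (split_ordP j) => {}j ->;
    rewrite /ord3Ci !simp //.
  - case: (split_ordP i) => {}i ->; case: (split_ordP j) => {}j ->; by rewrite !simp.
  - case: (split_ordP i) => {}i ->; by rewrite !simp.
  - case: (split_ordP j) => {}j ->; by rewrite !simp.
suff <- : mxsub (@ord3C n1 n2 n3) (@ord3C n1 n2 n3)
    (block_mx (block_mx A E F B) (col_mx U1 U2) (row_mx V1 V2) X) =
    block_mx B (row_mx F U2) (col_mx E V2) (block_mx A U1 V1 X) by exact: mxrank_mxsub.
apply/matrixP => i j; rewrite mxE.
case: (split_ordP i) => {}i ->; case: (split_ordP j) => {}j ->;
    rewrite /ord3C !simp //.
- case: (split_ordP j) => {}j ->; by rewrite !simp.
- case: (split_ordP i) => {}i ->; by rewrite !simp.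
- case: (split_ordP i) => {}i ->; case: (split_ordP j) => {}j ->; by rewrite !simp.
Qed.

End BlockRank.

(* [Node a b] is the rooted tree obtained by adding to the root of [a] a new
   child carrying the rooted tree [b]; the vertices of a tree are its leaves as
   a binary tree, and its root is the leftmost leaf. *)
Inductive btree := Leaf | Node of btree & btree.

Fixpoint nvert (t : btree) : nat :=
  match t with Leaf => 1%N | Node a b => (nvert a + nvert b)%N end.

Lemma nvert_gt0 t : (0 < nvert t)%N.
Proof. by elim: t => //= a Ha b _; rewrite addn_gt0 Ha. Qed.

(** A binary subtree is a vertex together with the branches at its youngest children, any number of
    them. It meets the rest of the tree only at its root. *)
Inductive swap (s s' : btree) : btree -> btree -> Prop :=
| swap_here : swap s s' s s'
| swap_l a a' b : swap s s' a a' -> swap s s' (Node a b) (Node a' b)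
| swap_r a b b' : swap s s' b b' -> swap s s' (Node a b) (Node a b').

Lemma swap_nvert s s' t t' : nvert s = nvert s' -> swap s s' t t' -> nvert t = nvert t'.
Proof. by move=> ss; elim=> //= a b c _ ->. Qed.

Section Btree.
Variables (K : fieldType) (lam : K).

Fixpoint rootv (t : btree) : 'rV[K]_(nvert t) :=
  match t return 'rV[K]_(nvert t) with
  | Leaf => const_mx 1
  | Node a b => row_mx (rootv a) 0
  end.

(* The adjacency matrix minus [lam%:M], the vertices being listed in the order of
   the leaves. *)
Fixpoint charm (t : btree) : 'M[K]_(nvert t) :=
  match t return 'M[K]_(nvert t) with
  | Leaf => - lam%:M
  | Node a b => block_mx (charm a) ((rootv a)^T *m rootv b)
                         ((rootv b)^T *m rootv a) (charm b)
  end.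

Definition mult (t : btree) : nat := (nvert t - \rank (charm t))%N.

Lemma charm_sym t : (charm t)^T = charm t.
Proof.
elim: t => [|a IHa b IHb] /=; first by rewrite linearN /= tr_scalar_mx.
by rewrite tr_block_mx IHa IHb !trmx_mul !trmxK.
Qed.

Lemma rank_mult t : (\rank (charm t) + mult t = nvert t)%N.
Proof. by rewrite subnKC // rank_leq_row. Qed.

Lemma mult_ge n t (U : 'M[K]_(n, nvert t)) :
  row_free U -> U *m charm t = 0 -> (n <= mult t)%N.
Proof.
move=> /eqP fU /sub_kermxP/mxrankS; rewrite fU mxrank_ker; exact.
Qed.

Lemma mxrank_outer m n (u : 'rV[K]_m) (v : 'rV[K]_n) : (\rank (u^T *m v) <= 1)%N.
Proof. by apply: leq_trans (mxrankM_maxl _ _) _; rewrite mxrank_tr rank_leq_row. Qed.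

(** The edge between the two roots contributes two blocks of rank at most one, so removing it
    changes the rank by at most [2]. *)
Lemma mult_Node_bounds a b :
  (mult (Node a b) <= mult a + mult b + 2)%N /\ (mult a + mult b <= mult (Node a b) + 2)%N.
Proof.
pose c : 'M[K]_(nvert a + nvert b) :=
  block_mx 0 ((rootv a)^T *m rootv b) ((rootv b)^T *m rootv a) 0.
have rc : (\rank c <= 2)%N.
  pose E := (rootv a)^T *m rootv b; pose E' := (rootv b)^T *m rootv a.
  have -> : c = block_mx 0 E 0 0 + block_mx 0 0 E' 0.
    by rewrite add_block_mx !addr0 !add0r.
  apply: leq_trans (mxrank_add _ _) _; rewrite !block_mxEv.
  rewrite !row_mx0 rank_col_mx0 rank_col_0mx rank_row_0mx rank_row_mx0.
  by apply: (@leq_add _ _ 1 1); exact: mxrank_outer.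
have dE : charm (Node a b) = block_mx (charm a) 0 0 (charm b) + c.
  by rewrite /= add_block_mx !addr0 !add0r.
have r1 : (\rank (charm (Node a b)) <= \rank (charm a) + \rank (charm b) + 2)%N.
  rewrite dE -rank_diag_block_mx; apply: leq_trans (mxrank_add _ _) _.
  by rewrite leq_add2l.
have r2 : (\rank (charm a) + \rank (charm b) <= \rank (charm (Node a b)) + 2)%N.
  rewrite -rank_diag_block_mx -[block_mx _ _ _ _](addrK c) -dE.
  by apply: leq_trans (mxrank_add _ _) _; rewrite mxrank_opp leq_add2l.
have := rank_mult a; have := rank_mult b; have /= := rank_mult (Node a b).
move: r1 r2 => /=; lia.
Qed.

(** The tree [t] inside a larger weighted graph: its root is joined, with weights [u], to further
    vertices that carry the matrix [X]. *)
Definition bord (t : btree) m (u : 'rV[K]_m) (X : 'M[K]_m) : 'M[K]_(nvert t + m) :=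
  block_mx (charm t) ((rootv t)^T *m u) (u^T *m rootv t) X.

(** Seen from one of its two halves, a bordered [Node] is that half with a larger border, which
    contains the other half. This drives the induction on the position of a subtree. *)
Lemma bord_Node_l a b m (u : 'rV[K]_m) (X : 'M[K]_m) :
  \rank (bord (Node a b) u X) =
  \rank (bord a (row_mx (rootv b) u) (block_mx (charm b) 0 0 X)).
Proof.
rewrite /bord /= [in LHS]tr_row_mx [in LHS]mul_col_mx [in LHS]mul_mx_row
  (@mxrank_block3A K (nvert a) (nvert b) m) trmx0 mul0mx mulmx0.
by rewrite tr_row_mx mul_mx_row mul_col_mx.
Qed.

Lemma bord_Node_r a b m (u : 'rV[K]_m) (X : 'M[K]_m) :
  \rank (bord (Node a b) u X) =
  \rank (bord b (row_mx (rootv a) 0)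
     (block_mx (charm a) ((rootv a)^T *m u) (u^T *m rootv a) X)).
Proof.
rewrite /bord /= [in LHS]tr_row_mx [in LHS]mul_col_mx [in LHS]mul_mx_row
  (@mxrank_block3C K (nvert a) (nvert b) m) trmx0 mul0mx mulmx0.
by rewrite tr_row_mx mul_mx_row mul_col_mx trmx0 mul0mx mulmx0.
Qed.

Lemma bord0 t (u : 'rV[K]_0) (X : 'M[K]_0) : \rank (bord t u X) = \rank (charm t).
Proof.
by rewrite /bord [_ *m u]thinmx0 [u^T *m _]flatmx0 [X]flatmx0 rank_diag_block_mx mxrank0 addn0.
Qed.

(* When the root is killed, it has no influence on the rank of the matrix of a
   tree extending [t] by edges at the root: elimination uses the certificate. *)
Definition killed (t : btree) : Prop :=
  exists2 z : 'rV[K]_(nvert t), z *m charm t = rootv t & z *m (rootv t)^T = 0.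

Lemma killed_bord t m (u : 'rV[K]_m) (X : 'M[K]_m) :
  killed t -> \rank (bord t u X) = (\rank (charm t) + \rank X)%N.
Proof.
move=> [z zM ze]; rewrite -rank_diag_block_mx.
(* Congruence by [L] creates the off-diagonal blocks because [z] is sent to the root vector, and
   leaves [X] unchanged because [z] vanishes at the root. *)
pose L : 'M[K]_(nvert t + m) := block_mx 1%:M 0 (u^T *m z) 1%:M.
have uL : L \in unitmx by rewrite unitmxE det_lblock !det1 mulr1 unitr1.
have uU : L^T \in unitmx by rewrite unitmx_tr.
have -> : bord t u X = L *m block_mx (charm t) 0 0 X *m L^T.
  have Mz : charm t *m z^T = (rootv t)^T by rewrite -zM trmx_mul charm_sym.
  rewrite tr_block_mx !trmx1 trmx0 trmx_mul trmxK !mulmx_block.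
  rewrite !(mulmx0, mul0mx, mulmx1, mul1mx, addr0, add0r) -!mulmxA zM.
  by rewrite [charm t *m _]mulmxA Mz [z *m (_ *m u)]mulmxA ze mul0mx mulmx0 add0r.
by rewrite mxrankMfree ?row_free_unit // (eqmxMfull _ (_ : row_full L)) ?row_full_unit.
Qed.

Lemma killed_Node a b : killed a -> killed (Node a b).
Proof.
move=> [z zM ze]; exists (row_mx z 0); rewrite /=.
  by rewrite mul_row_block !mul0mx !addr0 zM mulmxA ze mul0mx.
by rewrite tr_row_mx mul_row_col ze mul0mx addr0.
Qed.

Lemma mult_killed_Node a b : killed a -> mult (Node a b) = (mult a + mult b)%N.
Proof.
move=> ka; have := killed_bord (rootv b) (charm b) ka; rewrite /bord => H.
have := rank_mult a; have := rank_mult b; have /= := rank_mult (Node a b).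
by rewrite H /mult /= H; lia.
Qed.

(** At the copy itself, [killed_bord] splits off the rank of [s] or [s'] and leaves the same border
    [X]. Arbitrary borders are needed for the induction on the position of the copy. *)
Lemma swap_rank_bord s s' t t' : killed s -> killed s' -> swap s s' t t' ->
  forall m (u : 'rV[K]_m) (X : 'M[K]_m),
  (\rank (bord t u X) + \rank (charm s') = \rank (bord t' u X) + \rank (charm s))%N.
Proof.
move=> ks ks'; elim=> [|a a' b _ IH|a b b' _ IH] m u X.
- by rewrite !killed_bord //; lia.
- by rewrite !bord_Node_l.
- by rewrite !bord_Node_r.
Qed.

Lemma swap_mult s s' t t' : killed s -> killed s' -> nvert s = nvert s' ->
  swap s s' t t' -> (mult t + mult s' = mult t' + mult s)%N.
Proof.
move=> ks ks' ss sw; have := swap_nvert ss sw.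
have := swap_rank_bord ks ks' sw (0 : 'rV[K]_0) (0 : 'M[K]_0); rewrite !bord0.
have := rank_mult t; have := rank_mult t'; have := rank_mult s; have := rank_mult s'.
lia.
Qed.

Definition rooted_eigen (t : btree) : Prop :=
  exists2 x : 'rV[K]_(nvert t), x *m charm t = 0 & x *m (rootv t)^T = 1%:M.

(** Extended by [0] to [a], the eigenvector of the branch [t] violates only the equation at the root
    of [a], where it leaves [1]: this is the certificate. *)
Lemma rooted_eigen_killed a t : rooted_eigen t -> killed (Node a t).
Proof.
move=> [x xM xe]; exists (row_mx 0 x); rewrite /=.
  by rewrite mul_row_block !mul0mx !add0r xM mulmxA xe mul1mx.
by rewrite tr_row_mx mul_row_col mul0mx trmx0 mulmx0 addr0.
Qed.

Lemma rooted_eigen_neq0 t (x : 'rV[K]_(nvert t)) : x *m (rootv t)^T = 1%:M -> x != 0.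
Proof.
move=> xe; apply/eqP => x0; move: xe; rewrite x0 mul0mx.
by move/matrixP/(_ 0 0); rewrite !mxE => /eqP; rewrite eq_sym oner_eq0.
Qed.

Lemma rooted_eigen_mult t : rooted_eigen t -> (0 < mult t)%N.
Proof.
move=> [x xM xe]; apply: (@mult_ge 1 t x) => //.
by rewrite /row_free rank_rV (rooted_eigen_neq0 xe).
Qed.

Fixpoint occ (s t : btree) : nat :=
  if `[< t = s >] then 1%N else
  match t with Leaf => 0%N | Node a b => (occ s a + occ s b)%N end.

(* Two copies of [t0] hanging from the same vertex carry an antisymmetric
   eigenvector, which vanishes at that vertex: extended by [0] it is an
   eigenvector of every tree containing them. *)
Lemma occ_le_mult t0 t : rooted_eigen t0 ->
  (occ (Node (Node Leaf t0) t0) t <= mult t)%N.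
Proof.
move=> et0; set s := Node _ _.
suff [U fU [UM _]] : exists2 U : 'M[K]_(occ s t, nvert t), row_free U &
    U *m charm t = 0 /\ U *m (rootv t)^T = 0 by apply: mult_ge fU UM.
elim: t => [|a [Ua fa [Ma ea]] b [Ub fb [Mb eb]]].
  rewrite /= asboolF //; exists 0; first by rewrite /row_free mxrank0.
  by split; rewrite mul0mx.
rewrite /=; case: asboolP => [[-> ->]|_].
  have [z zM ze] := rooted_eigen_killed Leaf et0; have [x xM xe] := et0.
  exists (row_mx z (- x)).
    rewrite /row_free rank_rV; suff -> : row_mx z (- x) != 0 by [].
    by rewrite row_mx_eq0 oppr_eq0 (negPf (rooted_eigen_neq0 xe)) andbF.
  split; last by rewrite tr_row_mx mul_row_col trmx0 mulmx0 addr0.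
  rewrite mul_row_block zM !mulNmx xM oppr0 addr0 !mulmxA xe ze mul1mx mul0mx.
  by rewrite subrr row_mx0.
exists (block_mx Ua 0 0 Ub).
  by rewrite /row_free rank_diag_block_mx (eqP fa) (eqP fb).
split; last first.
  by rewrite tr_row_mx block_mxEv mul_col_mx !mul_row_col trmx0 ea !(mulmx0, mul0mx, addr0) col_mx0.
rewrite mulmx_block !mul0mx !addr0 !add0r Ma Mb !mulmxA ea eb !mul0mx.
by rewrite block_mxEv !row_mx0 col_mx0.
Qed.

(** A single vertex works for [lam != 0], and a single edge for [lam = 0] since its matrix squares
    to the identity. Such a tree adds vertices without adding multiplicity. *)
Lemma mult_eq0_exists : exists t, mult t = 0%N.
Proof.
have [l0|l0] := eqVneq lam 0; last first.
  exists Leaf; rewrite /mult /=.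
  by rewrite -scalemx1 mxrank_opp mxrank_scale_nz // mxrank1.
exists (Node Leaf Leaf); apply/eqP; rewrite subn_eq0 /=.
set M := block_mx _ _ _ _.
suff MM : M *m M = 1%:M by rewrite -[X in (X <= _)%N](mxrank1 K) -MM mxrankM_maxl.
have e1 : (const_mx 1 : 'rV[K]_1)^T *m const_mx 1 = 1%:M.
  by apply/matrixP => i j; rewrite !mxE big_ord1 !mxE mulr1 !ord1.
have s0 : 0%:M = 0 :> 'M[K]_1 by rewrite -scalemx1 scale0r.
rewrite /M l0 e1 s0 oppr0 mulmx_block !mul0mx !mulmx0 !mul1mx !add0r !addr0.
by rewrite -scalar_mx_block.
Qed.

End Btree.

(* [beta] is the sum of the values, at the children of the root, of a vector
   equal to [1] at the root and satisfying the eigenvalue equation everywhere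
   else. *)
Definition reach (K : fieldType) (lam beta : K) : Prop :=
  exists (t : btree) (x : 'rV[K]_(nvert t)),
    x *m charm lam t = (beta - lam) *: rootv K t /\ x *m (rootv K t)^T = 1%:M.

Lemma reach0 (K : fieldType) (lam : K) : reach lam 0.
Proof.
exists Leaf, (const_mx 1); split; last first.
  by apply/matrixP => i j; rewrite !mxE big_ord1 !mxE mulr1 !ord1.
by rewrite /= mulmxN mul_mx_scalar sub0r scaleNr.
Qed.

(** The vector on [b] is scaled by [1 / (lam - gamma)], so that the equation at the root of [b]
    holds with its new neighbour of value [1]; the root of [a] then gains a child with this
    value. *)
Lemma reach_step (K : fieldType) (lam beta gamma : K) :
  reach lam beta -> reach lam gamma -> gamma != lam ->
  reach lam (beta + (lam - gamma)^-1).
Proof.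
move=> [a [x [xM xe]]] [b [y [yM ye]]] gl.
have l0 : lam - gamma != 0 by rewrite subr_eq0 eq_sym.
exists (Node a b), (row_mx x ((lam - gamma)^-1 *: y)); split; last first.
  by rewrite /= tr_row_mx mul_row_col trmx0 mulmx0 addr0.
rewrite /= mul_row_block -!scalemxAl !mulmxA xM yM xe ye !mul1mx scale_row_mx scaler0.
congr row_mx; first by rewrite -scalerDl; congr (_ *: _); ring.
rewrite scalerA -{1}[rootv K b]scale1r -scalerDl.
suff -> : 1 + (lam - gamma)^-1 * (gamma - lam) = 0 by rewrite scale0r.
by field.
Qed.

(* Salez's theorem. By [reach_step], the increments that preserve reachability
   are closed under [d |-> 1 / (alpha - d)]; dividing them by [alpha] gives a set
   to which [salez_closed_one] applies. *)
Lemma rooted_eigen_exists (R : realType) (alpha : R) :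
  totally_real_algebraic_integer alpha -> exists t, rooted_eigen alpha t.
Proof.
move=> ha; suff [t [x [xM xe]]] : reach alpha alpha.
  by exists t, x => //; rewrite xM subrr scale0r.
have [->|a0] := eqVneq alpha 0; first exact: reach0.
pose W d := forall beta, reach alpha beta -> reach alpha (beta + d).
have WR d : W d -> reach alpha d by move/(_ 0 (reach0 alpha)); rewrite add0r.
suff : W (alpha * 1) by rewrite mulr1 => /WR.
apply: (salez_closed_one (F := fun y => W (alpha * y)) ha a0); split.
- by move=> b; rewrite mulr0 addr0.
- by move=> y z Wy Wz b Rb; rewrite mulrDr addrA; apply/Wz/Wy.
move=> y Wy y1 b Rb.
have -> : alpha * ((alpha ^+ 2)^-1 / (1 - y)) = (alpha - alpha * y)^-1.
  have y0 : 1 - y != 0 by rewrite subr_eq0 eq_sym.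
  by field; rewrite a0 y0 -[X in X - _]mulr1 -mulrBr mulf_neq0.
apply: reach_step => //; first exact: WR.
by apply: contra_neq y1 => /(congr1 (fun z => z / alpha)); rewrite mulrAC divff // mul1r.
Qed.

(** * Recursive trees as histories of growth *)

Section RecursiveTrees.
Local Open Scope nat_scope.

(** * Recursive trees described by parents *)

Section Parent.
Variables (n : nat) (e : rel 'I_n.+1).

Definition parental : Prop :=
  [/\ symmetric e, irreflexive e,
      forall j : 'I_n.+1, (0 < j)%N -> exists2 i : 'I_n.+1, (i < j)%N & e i j &
      forall i i' j : 'I_n.+1, (i < j)%N -> (i' < j)%N -> e i j -> e i' j -> i = i'].

Lemma parental_connect : parental -> forall j, connect e ord0 j.
Proof.
move=> [_ _ ex _] j; have [m] := ubnP (val j); elim: m j => // m IH j jm.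
have [j0|j0] := posnP (val j).
  by have -> : j = ord0 by apply: val_inj.
have [i ij eij] := ex j j0.
apply: connect_trans (connect1 eij); apply: IH; move: ij jm => /=; lia.
Qed.

(** After an ascent from [a] to [b], a descent could only lead back to [a], the unique smaller
    neighbour of [b]. *)
Lemma parental_sorted : parental -> forall (a b : 'I_n.+1) s,
  (a < b)%N -> e a b -> path e b s -> uniq (a :: b :: s) ->
  path ltn (val b) (map val s).
Proof.
move=> [sym irr ex un] a b s; elim: s a b => //= c s IH a b ab eab /andP[ebc ps].
rewrite !inE !negb_or => /andP[/and3P[anb anc ans] /andP[/andP[bnc bns] /andP[cns us]]].
have bc : (b < c)%N.
  rewrite ltn_neqAle bnc leqNgt; apply/negP => cb.
  by move/eqP: anc; apply; apply: (un a c b) => //; rewrite sym.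
rewrite bc /=; apply: (IH b c) => //=.
by rewrite !inE negb_or bnc bns cns.
Qed.

(** The largest vertex of a longer cycle would have two distinct smaller neighbours. *)
Lemma parental_cycle : parental -> forall c : seq 'I_n.+1, ucycle e c -> (size c <= 2)%N.
Proof.
move=> [sym irr ex un] c; case: c => [//|x0 c0] /andP[].
set c := x0 :: c0 => cyc uc; rewrite leqNgt; apply/negP => sc.
have x0c : x0 \in c by rewrite mem_head.
have [v vc vmax] : exists2 v, v \in c & forall w, w \in c -> (w <= v)%N.
  case: (@arg_maxnP _ x0 (fun i => i \in c) (fun i => val i) x0c) => v vc H.
  by exists v => // w wc; apply: H.
have [i c' Ec] := rot_to vc.
move: cyc uc sc; rewrite -(rot_cycle i) -(rot_uniq i) -(size_rot i) Ec.
have cmax w : w \in c' -> (w <= v)%N.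
  by move=> wc; apply: vmax; rewrite -(mem_rot i) Ec inE wc orbT.
case: c' {Ec} cmax => [//|x c'] cmax; case/lastP: c' cmax => [//|c' y] cmax.
rewrite /= rcons_path last_rcons => /and3P[evx _ eyv] /andP[vn /andP[xn _]] _.
have xv : (x < v)%N.
  rewrite ltn_neqAle cmax ?mem_head // andbT; apply: contraNneq vn => xv.
  by rewrite -(val_inj xv) mem_head.
have yv : (y < v)%N.
  have yin : y \in x :: rcons c' y by rewrite inE mem_rcons mem_head orbT.
  rewrite ltn_neqAle cmax // andbT; apply: contraNneq vn => yv.
  by rewrite -(val_inj yv).
have xy : x = y by apply: (un x y v) => //; rewrite sym.
by move: xn; rewrite xy mem_rcons mem_head.
Qed.

Lemma parental_recursive : parental -> is_recursive_tree ord0 e.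
Proof.
move=> par; have [sym irr ex un] := par; split.
  split=> //; last exact: parental_cycle.
  move=> x y; apply: connect_trans (parental_connect par y).
  by rewrite (sym_connect_sym sym); apply: parental_connect.
case=> [//|b s] /= /andP[e0b ps] us.
have b0 : (0 < b)%N.
  rewrite lt0n; apply/eqP => b0; have : b = ord0 by apply: val_inj.
  by move=> E; move: e0b; rewrite E irr.
rewrite /= b0 /=; exact: (parental_sorted par (a := ord0) b0 e0b ps).
Qed.

(** Labels increase along the path from the root to [0], so the root is [0]; the parent of [j]
    precedes it on the path from the root. Two smaller neighbours of [j] would be connected through
    vertices below [j], and [j] would close a cycle. *)
Lemma recursive_parental r : is_recursive_tree r e -> r = ord0 /\ parental.
Proof.
move=> [[sym irr con cyc] inc].
have upath j : exists s, [/\ path e r s, uniq (r :: s), last r s = j &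
    path ltn (val r) (map val s)].
  case/connectP: (con r j) => s0 ps0 ->.
  case: (shortenP ps0) => s ps us _; exists s; split=> //.
  exact: (inc s ps us).
have leq_last (a : 'I_n.+1) s : path ltn (val a) (map val s) ->
    all (fun x : 'I_n.+1 => (x <= last a s)%N) (a :: s).
  elim: s a => [|b s IH] a /=; first by rewrite leqnn.
  move=> /andP[ab /IH /= /andP[H1 H2]]; rewrite H1 H2 !andbT.
  exact: leq_trans (ltnW ab) H1.
have r0 : r = ord0.
  have [s [_ _ ls /leq_last /andP[]]] := upath ord0; rewrite ls leqn0 => /eqP H _.
  exact: val_inj.
split=> //; split=> // [j j0|i i' j ij i'j eij ei'j].
  have [s [ps us ls Hs]] := upath j.
  case/lastP: s ps us ls Hs => [|s x] ps us ls Hs.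
    by move: ls j0 => /= <-; rewrite r0.
  move: ps ls Hs; rewrite last_rcons map_rcons !rcons_path => /andP[_ exj] xj /andP[_ lt].
  by rewrite -xj; exists (last r s) => //; move: lt; rewrite last_map.
apply/eqP; apply: contraT => ii'.
pose e' := [rel a b : 'I_n.+1 | [&& e a b, (a < j)%N & (b < j)%N]].
have sym' : symmetric e' by move=> a b /=; rewrite sym [(a < j)%N && _]andbC.
have con' (k : 'I_n.+1) : (k < j)%N -> connect e' r k.
  move=> kj; have [s [ps us ls Hs]] := upath k.
  apply/connectP; exists s => //.
  have : all (fun x : 'I_n.+1 => (x < j)%N) (r :: s).
    apply: sub_all (leq_last _ _ Hs) => x; rewrite ls => xk; exact: leq_ltn_trans xk kj.
  elim: (s) (r) ps => //= b s' IH a /andP[eab ps'] /and3P[aj bj sj].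
  by rewrite eab aj bj IH //= bj.
have /connectP[s0 ps0 ls0] : connect e' i i'.
  apply: connect_trans (con' _ i'j).
  by rewrite (sym_connect_sym sym'); apply: con'.
move: ls0; case: (shortenP ps0) => s ps us _ ls.
have sj : all (fun x : 'I_n.+1 => (x < j)%N) s.
  elim: (s) (i) ps => //= b s' IH a /andP[/and3P[_ _ bj] ps'].
  by rewrite bj; apply: IH ps'.
have : ucycle e (j :: i :: s).
  apply/andP; split; last first.
    rewrite cons_uniq us andbT inE negb_or -val_eqE /= gtn_eqF //=.
    by apply/negP => js; have /allP/(_ _ js) := sj; rewrite ltnn.
  rewrite /= sym eij rcons_path -ls ei'j andbT /=.
  by apply: sub_path ps => a b /= /and3P[].
move/cyc; case: (s) ls => //= E; by rewrite E eqxx in ii'.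
Qed.

End Parent.

(** Replacing the leaf of a vertex by [Node Leaf Leaf] gives this vertex a new youngest child,
    placed deepest. The top [Node] of a tree thus always splits off the branch of the oldest child
    of the root. *)
Fixpoint grow (t : btree) : seq btree :=
  match t with
  | Leaf => [:: Node Leaf Leaf]
  | Node a b => [seq Node a' b | a' <- grow a] ++ [seq Node a b' | b' <- grow b]
  end.

(* The trees with [k] edges, each repeated as many times as it arises from the
   [k!] histories of the growth of a recursive tree. *)
Fixpoint rtrees (k : nat) : seq btree :=
  if k is k'.+1 then flatten [seq grow t | t <- rtrees k'] else [:: Leaf].

(** * Labelled trees and their adjacency matrices *)

Inductive ltree := LLeaf of nat | LNode of ltree & ltree.

Fixpoint labels (t : ltree) : seq nat :=
  match t with LLeaf i => [:: i] | LNode a b => labels a ++ labels b end.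
Fixpoint lroot (t : ltree) : nat :=
  match t with LLeaf i => i | LNode a b => lroot a end.
Fixpoint unlabel (t : ltree) : btree :=
  match t with LLeaf i => Leaf | LNode a b => Node (unlabel a) (unlabel b) end.
Fixpoint ledge (t : ltree) (i j : nat) : bool :=
  match t with
  | LLeaf _ => false
  | LNode a b => [|| ledge a i j, ledge b i j, (i == lroot a) && (j == lroot b)
                   | (j == lroot a) && (i == lroot b)]
  end.
Fixpoint lgrow (k v : nat) (t : ltree) : ltree :=
  match t with
  | LLeaf i => if i == v then LNode (LLeaf i) (LLeaf k) else LLeaf i
  | LNode a b => LNode (lgrow k v a) (lgrow k v b)
  end.

Lemma lroot_labels t : lroot t \in labels t.
Proof. by elim: t => [i|a IH b _] /=; rewrite ?mem_head // mem_cat IH. Qed.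

Lemma size_labels t : size (labels t) = nvert (unlabel t).
Proof. by elim: t => //= a IHa b IHb; rewrite size_cat IHa IHb. Qed.

Lemma lroot_lgrow k v t : lroot (lgrow k v t) = lroot t.
Proof. by elim: t => //= i; case: eqP. Qed.

Lemma lgrow_id k v t : v \notin labels t -> lgrow k v t = t.
Proof.
elim: t => [i|a IHa b IHb] /=; first by rewrite inE eq_sym => /negPf->.
by rewrite mem_cat negb_or => /andP[/IHa-> /IHb->].
Qed.

Lemma labels_lgrow k v t : uniq (labels t) -> v \in labels t ->
  perm_eq (labels (lgrow k v t)) (k :: labels t).
Proof.
elim: t => [i|a IHa b IHb] /=.
  by rewrite inE eq_sym => _ ->; rewrite /= (perm_catC [:: i] [:: k]).
rewrite cat_uniq mem_cat => /and3P[ua /hasPn dab ub] /orP[va|vb].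
  have vb : v \notin labels b by apply/negP => /dab; rewrite /= va.
  by rewrite (lgrow_id k vb) -cat_cons perm_cat2r IHa.
have va : v \notin labels a by apply: (dab v vb).
rewrite (lgrow_id k va); apply: perm_trans (_ : perm_eq (labels a ++ k :: labels b) _).
  by rewrite perm_cat2l IHb.
by rewrite -cat_cons -cat1s catA (perm_cat2r (labels b) _ (k :: labels a)) perm_catC.
Qed.

Lemma ledge_lgrow k v t i j : ledge (lgrow k v t) i j =
  ledge t i j || ((v \in labels t) && ((i == v) && (j == k) || (j == v) && (i == k))).
Proof.
elim: t => [u|a IHa b IHb] /=.
  by rewrite inE [v == u]eq_sym; case: eqP => [->|] //=.
rewrite !lroot_lgrow IHa IHb mem_cat.
move: ((i == lroot a) && _) ((j == lroot a) && _) ((i == v) && _ || _) => x y z.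
by case: (ledge a i j); case: (ledge b i j); case: (v \in labels a);
   case: (v \in labels b); case: x; case: y; case: z.
Qed.

Lemma ledge_labels t i j : ledge t i j -> (i \in labels t) && (j \in labels t).
Proof.
elim: t => //= a IHa b IHb; rewrite !mem_cat.
case/or4P => [/IHa/andP[-> ->]|/IHb/andP[-> ->]|/andP[/eqP-> /eqP->]|/andP[/eqP-> /eqP->]];
by rewrite ?orbT // !lroot_labels ?orbT.
Qed.

Lemma unlabel_lgrow k t : uniq (labels t) ->
  [seq unlabel (lgrow k v t) | v <- labels t] = grow (unlabel t).
Proof.
elim: t => [i|a IHa b IHb] /=; first by rewrite eqxx.
rewrite cat_uniq => /and3P[ua /hasPn dab ub]; rewrite map_cat -IHa // -IHb // -!map_comp.
congr cat; apply/eq_in_map => v vin /=.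
  by rewrite (@lgrow_id k v b) //; apply/negP => /dab; rewrite /= vin.
by rewrite (@lgrow_id k v a) //; apply: dab.
Qed.

Section Matrix.
Local Open Scope ring_scope.

Lemma rootv_entry (K : fieldType) t (i : 'I_1) (j : 'I_(nvert (unlabel t))) :
  uniq (labels t) -> rootv K (unlabel t) i j = (nth 0%N (labels t) j == lroot t)%:R.
Proof.
elim: t i j => [u|a IHa b IHb] i j /=.
  by move=> _; rewrite mxE; case: j => [[|j] hj] //=; rewrite eqxx.
rewrite cat_uniq => /and3P[ua /hasPn dab ub].
case: (split_ordP j) => {}j ->; rewrite ?row_mxEl ?row_mxEr nth_cat size_labels /=.
  by rewrite ltn_ord IHa.
rewrite ltnNge leq_addr /= addKn mxE; case: eqP => // E.
have := dab (lroot a); rewrite /= lroot_labels -E mem_nth ?size_labels // => /(_ isT).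
by [].
Qed.

Lemma charm_entry (K : fieldType) (lam : K) t (i j : 'I_(nvert (unlabel t))) :
  uniq (labels t) -> charm lam (unlabel t) i j =
   (ledge t (nth 0%N (labels t) i) (nth 0%N (labels t) j))%:R - lam *+ (i == j).
Proof.
elim: t i j => [u|a IHa b IHb] i j /=.
  by move=> _; rewrite !mxE !ord1 eqxx sub0r.
rewrite cat_uniq => /and3P[ua /hasPn dab ub].
have Na (x : 'I_(nvert (unlabel a))) : nth 0%N (labels a) x \in labels a.
  by rewrite mem_nth // size_labels.
have Nb (x : 'I_(nvert (unlabel b))) : nth 0%N (labels b) x \in labels b.
  by rewrite mem_nth // size_labels.
have nab x : x \in labels b -> x \in labels a -> False by move=> /dab /negP.
have F1 x y : x \in labels a -> ledge b x y = false.
  by move=> xa; apply/negP => /ledge_labels/andP[xb _]; exact: nab xb xa.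
have F2 x y : x \in labels b -> ledge a x y = false.
  by move=> xb; apply/negP => /ledge_labels/andP[xa _]; exact: nab xb xa.
have F1' x y : y \in labels a -> ledge b x y = false.
  by move=> xa; apply/negP => /ledge_labels/andP[_ xb]; exact: nab xb xa.
have F2' x y : y \in labels b -> ledge a x y = false.
  by move=> xb; apply/negP => /ledge_labels/andP[_ xa]; exact: nab xb xa.
have ra x : x \in labels b -> (x == lroot a) = false.
  by move=> xb; apply/negP => /eqP E; apply: (nab _ xb); rewrite E lroot_labels.
have rb x : x \in labels a -> (x == lroot b) = false.
  by move=> xa; apply/negP => /eqP E; apply: (nab _ _ xa); rewrite E lroot_labels.
case: (split_ordP i) => {}i ->; case: (split_ordP j) => {}j ->;
  rewrite ?block_mxEul ?block_mxEur ?block_mxEdl ?block_mxEdr !nth_cat !size_labels /=;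
  rewrite ?ltn_ord ?[(_ + _ < _)%N]ltnNge ?leq_addr /= ?addKn.
- rewrite IHa // F1 ?Na // !rb ?Na // !andbF !orbF.
  by congr (_ - lam *+ _); rewrite eq_lshift.
- rewrite F1 ?Na // F2' ?Nb // !mxE big_ord1 !mxE !rootv_entry //.
  rewrite (rb _ (Na i)) (ra _ (Nb j)) /= orbF.
  by rewrite -natrM mulnb eq_lrshift mulr0n subr0.
- rewrite F1' ?Na // F2 ?Nb // !mxE big_ord1 !mxE !rootv_entry //.
  rewrite (rb _ (Na j)) (ra _ (Nb i)) /=.
  by rewrite -natrM mulnb eq_rlshift mulr0n subr0 andbC.
- rewrite IHb // F2 ?Nb // !ra ?Nb //= orbF.
  by congr (_ - lam *+ _); rewrite eq_rshift.
Qed.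

End Matrix.

(* [p j] is the parent of the vertex [j > 0]. *)
Fixpoint ltree_of (p : nat -> nat) (k : nat) : ltree :=
  if k is k'.+1 then lgrow k'.+1 (p k'.+1) (ltree_of p k') else LLeaf 0.

Definition parents_below (p : nat -> nat) (k : nat) : Prop :=
  forall j, (0 < j <= k)%N -> (p j < j)%N.

Definition pedge (p : nat -> nat) (i j : nat) : bool :=
  (i < j)%N && (p j == i) || (j < i)%N && (p i == j).

Lemma ltree_of_ext p p' k :
  (forall j, (0 < j <= k)%N -> p j = p' j) -> ltree_of p k = ltree_of p' k.
Proof.
elim: k => //= k IH pp; rewrite IH ?pp ?leqnn // => j /andP[j0 jk].
by apply: pp; rewrite j0 ltnW.
Qed.

Lemma parents_belowW p k : parents_below p k.+1 -> parents_below p k.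
Proof. by move=> pb j /andP[j0 jk]; apply: pb; rewrite j0 ltnW. Qed.

Lemma labels_ltree_of p k : parents_below p k ->
  perm_eq (labels (ltree_of p k)) (iota 0 k.+1).
Proof.
elim: k => [//|k IH] pb; have {}IH := IH (parents_belowW pb).
have u : uniq (labels (ltree_of p k)) by rewrite (perm_uniq IH) iota_uniq.
have pk : p k.+1 \in labels (ltree_of p k).
  by rewrite (perm_mem IH) mem_iota /= add0n pb // leqnn.
apply: perm_trans (labels_lgrow _ u pk) _.
have -> : iota 0 k.+2 = rcons (iota 0 k.+1) k.+1 by rewrite -[k.+2]addn1 iotaD cats1.
by rewrite perm_sym perm_rcons perm_cons perm_sym.
Qed.

Lemma uniq_ltree_of p k : parents_below p k -> uniq (labels (ltree_of p k)).
Proof. by move/labels_ltree_of/perm_uniq => ->; rewrite iota_uniq. Qed.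

Lemma mem_ltree_of p k i : parents_below p k -> (i \in labels (ltree_of p k)) = (i <= k)%N.
Proof. by move/labels_ltree_of/perm_mem => ->; rewrite mem_iota. Qed.

Lemma nvert_ltree_of p k : parents_below p k -> nvert (unlabel (ltree_of p k)) = k.+1.
Proof. by move/labels_ltree_of/perm_size; rewrite size_labels size_iota. Qed.

Lemma ledge_ltree_of p k i j : parents_below p k -> (i <= k)%N -> (j <= k)%N ->
  ledge (ltree_of p k) i j = pedge p i j.
Proof.
elim: k i j => [|k IH] i j pb ik jk.
  by move: ik jk; rewrite !leqn0 => /eqP-> /eqP->.
have pb' := parents_belowW pb; have pk : (p k.+1 < k.+1)%N by apply: pb; rewrite leqnn.
have out x y : (k < x)%N || (k < y)%N -> ledge (ltree_of p k) x y = false.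
  move=> H; apply/negP => /ledge_labels; rewrite !mem_ltree_of //.
  by move: H => /orP[] H /andP[xk yk]; lia.
rewrite /= ledge_lgrow mem_ltree_of // -ltnS pk /=.
have [ik'|ik'] := ltnP k i; last first.
  have [jk'|jk'] := ltnP k j; last first.
    rewrite IH // [j == _]ltn_eqF // [i == k.+1]ltn_eqF //.
    by rewrite !andbF !orbF.
  have -> : j = k.+1 by apply/eqP; rewrite eqn_leq jk.
  rewrite out ?ltnSn ?orbT // /pedge eqxx andbT [i == k.+1]ltn_eqF // andbF orbF.
  rewrite ltnS ik' /= eq_sym; have -> : (k.+1 < i)%N = false by lia.
  by rewrite orbF.
have -> : i = k.+1 by apply/eqP; rewrite eqn_leq ik.
rewrite out ?ltnSn // /pedge eqxx andbT [k.+1 == _]eq_sym [p k.+1 == k.+1]ltn_eqF //=.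
have -> : (k.+1 < j)%N = false by lia.
rewrite /= [j == _]eq_sym; case: eqP => [<-|]; first by rewrite pk.
by rewrite andbF.
Qed.

Definition graph_of (p : nat -> nat) (k : nat) : rooted_graph k.+1 :=
  (ord0, [set ij : 'I_k.+1 * 'I_k.+1 | pedge p ij.1 ij.2]%SET).

Lemma adj_graph_of p k i j : adj (graph_of p k) i j = pedge p i j.
Proof. by rewrite /adj /= inE. Qed.

Section EigenMult.
Local Open Scope ring_scope.

(** Positions of leaves and labels are in bijection, by [f] and [g], and each matrix is a
    renumbering of the other. *)
Lemma eigen_mult_graph_of (R : realType) (alpha : R) p k : parents_below p k ->
  eigen_mult alpha (graph_of p k) = mult alpha (unlabel (ltree_of p k)).
Proof.
move=> pb; rewrite /eigen_mult /eigenspace mxrank_ker /mult.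
set t := ltree_of p k; have ut : uniq (labels t) by apply: uniq_ltree_of.
have nt := nvert_ltree_of pb; rewrite -/t in nt.
have lt_lab (i : 'I_(nvert (unlabel t))) : (nth 0%N (labels t) i < k.+1)%N.
  by rewrite ltnS -(mem_ltree_of _ pb) mem_nth // size_labels.
pose f (i : 'I_(nvert (unlabel t))) : 'I_k.+1 := Ordinal (lt_lab i).
have lt_idx (v : 'I_k.+1) : (index (val v) (labels t) < nvert (unlabel t))%N.
  by rewrite -size_labels index_mem (mem_ltree_of _ pb) -ltnS ltn_ord.
pose g (v : 'I_k.+1) : 'I_(nvert (unlabel t)) := Ordinal (lt_idx v).
have gK v : f (g v) = v.
  by apply: val_inj; rewrite /= nth_index // (mem_ltree_of _ pb) -ltnS ltn_ord.
have fK i : g (f i) = i.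
  by apply: val_inj; rewrite /= index_uniq // size_labels.
set M := _ - _; apply: (f_equal2 subn); first exact: esym nt.
have E : charm alpha (unlabel t) = mxsub f f M.
  apply/matrixP => i j; rewrite charm_entry // !mxE adj_graph_of.
  have ij : (f i == f j) = (i == j) by rewrite (can_eq fK).
  by rewrite ij ledge_ltree_of // -ltnS lt_lab.
have E' : M = mxsub g g (charm alpha (unlabel t)).
  by rewrite E; apply/matrixP => i j; rewrite !mxE !gK.
by apply/eqP; rewrite eqn_leq [in X in X && _]E' [in X in _ && X]E !mxrank_mxsub.
Qed.
End EigenMult.

(** * Encoding of recursive trees by lists of parents *)

Fixpoint codes (k : nat) : seq (seq nat) :=
  if k is k'.+1 then [seq rcons c v | c <- codes k', v <- iota 0 k'.+1] else [:: [::]].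

(** The root [0] has no parent, so that of [j > 0] is stored at index [j - 1]. *)
Definition parent_of (c : seq nat) (j : nat) : nat := nth 0%N c j.-1.

Lemma mem_codes k c : reflect (size c = k /\ parents_below (parent_of c) k) (c \in codes k).
Proof.
elim: k c => [|k IH] c.
  rewrite inE; apply: (iffP eqP) => [->|[/size0nil]] //.
  by split=> // j; case: j.
apply: (iffP idP) => [/allpairsPdep[c' [v [/IH[sc' pb]]]]|[sc pb]].
  rewrite mem_iota add0n => /andP[_ vk] ->; rewrite size_rcons sc'; split=> // j.
  case: j => // j; rewrite /parent_of /= nth_rcons sc' ltnS leq_eqVlt => /orP[/eqP->|jk].
    by rewrite ltnn eqxx.
  by rewrite jk; apply: (pb j.+1).
case/lastP: c sc pb => [//|c v]; rewrite size_rcons => -[sc] pb; apply/allpairsPdep.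
exists c, v; split=> //.
  apply/IH; split=> // j /andP[j0 jk].
  have := pb j; rewrite /parent_of nth_rcons sc j0 (leqW jk) => /(_ isT).
  by case: j j0 jk => //= j _ ->.
have := pb k.+1; rewrite /parent_of /= nth_rcons sc ltnn eqxx leqnn => /(_ isT) vk.
by rewrite -[_ :: _]/(iota 0 k.+1) mem_iota.
Qed.

Lemma codes_uniq k : uniq (codes k).
Proof.
elim: k => // k IH.
rewrite -[codes _]/[seq rcons c v | c <- codes k, v <- iota 0 k.+1].
apply: allpairs_uniq IH (iota_uniq _ _) _.
by move=> [c v] [c' v'] _ _ /= /rcons_inj[-> ->].
Qed.

Lemma parent_of_rcons c v j :
  (0 < j)%N -> parent_of (rcons c v) j =
    if (j <= size c)%N then parent_of c j else if j == (size c).+1 then v else 0%N.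
Proof. by case: j => // j _; rewrite /parent_of nth_rcons /= eqSS. Qed.

Lemma sum_rtreesS (V : nmodType) k (F : btree -> V) :
  (\sum_(t <- rtrees k.+1) F t = \sum_(t <- rtrees k) \sum_(t' <- grow t) F t')%R.
Proof. by rewrite [rtrees _]/= big_flatten big_map. Qed.

(** When the parent of the new vertex runs over all labels, the resulting shapes form the list
    [grow] ([unlabel_lgrow]). Uniform recursive trees thus become uniform entries of [rtrees k]. *)
Lemma sum_rtrees_codes (V : nmodType) k (F : btree -> V) :
  (\sum_(t <- rtrees k) F t =
   \sum_(c <- codes k) F (unlabel (ltree_of (parent_of c) k)))%R.
Proof.
elim: k F => [|k IH] F; first by rewrite !big_seq1.
rewrite sum_rtreesS IH.
rewrite -[codes k.+1]/[seq rcons c v | c <- codes k, v <- iota 0 k.+1] big_allpairs_dep.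
rewrite [LHS]big_seq [RHS]big_seq; apply: eq_bigr => c /mem_codes[sc pb] /=.
rewrite -(unlabel_lgrow k.+1 (uniq_ltree_of pb)) big_map.
rewrite (perm_big _ (labels_ltree_of pb)) [LHS]big_seq [RHS]big_seq.
apply: eq_bigr => v; rewrite mem_iota add0n => /andP[_ vk].
rewrite parent_of_rcons // sc ltnn eqxx; congr (F (unlabel (lgrow _ _ _))).
by apply: ltree_of_ext => j /andP[j0 jk]; rewrite parent_of_rcons // sc jk.
Qed.

Lemma graph_of_inj k c c' : c \in codes k -> c' \in codes k ->
  graph_of (parent_of c) k = graph_of (parent_of c') k -> c = c'.
Proof.
move=> /mem_codes[sc pb] /mem_codes[sc' pb'] E.
apply: (@eq_from_nth _ 0%N) => [|j]; first by rewrite sc sc'.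
rewrite sc => jk; have jk1 : (0 < j.+1 <= k)%N by [].
have h : (j.+1 < k.+1)%N by [].
have pl := pb _ jk1; have pk : (parent_of c j.+1 < k.+1)%N by lia.
have : adj (graph_of (parent_of c) k) (Ordinal pk) (Ordinal h).
  by rewrite adj_graph_of /pedge /= pl eqxx.
rewrite E adj_graph_of /pedge /= pl /= => /orP[/eqP //|/andP[]]; lia.
Qed.

Lemma pedge_parental p k : parents_below p k ->
  parental (fun i j : 'I_k.+1 => pedge p i j).
Proof.
move=> pb; split.
- by move=> i j; rewrite /pedge orbC.
- by move=> i; rewrite /pedge ltnn.
- move=> j j0; have pl : (p j < j)%N by apply: pb; rewrite j0 -ltnS ltn_ord.
  exists (Ordinal (ltn_trans pl (ltn_ord j))) => //.
  by rewrite /pedge /= pl eqxx.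
- move=> i i' j ij i'j; rewrite /pedge ij i'j /=.
  rewrite ![(j < _)%N]ltnNge (ltnW ij) (ltnW i'j) /= !orbF => /eqP pi /eqP pi'.
  by apply: val_inj; rewrite /= -pi -pi'.
Qed.

Lemma parental_pedge k (e : rel 'I_k.+1) : parental e ->
  exists2 c, c \in codes k & forall i j, e i j = pedge (parent_of c) i j.
Proof.
move=> [sym irr ex un].
pose P (j i : 'I_k.+1) := (i < j)%N && e i j.
(* Index [j] holds the parent of the vertex [j + 1]; the default [0] never arises, since every
   vertex but [0] has a parent. *)
pose c := [seq (if [pick i | P (inord j.+1) i] is Some i then val i else 0%N) | j <- iota 0 k].
have sc : size c = k by rewrite size_map size_iota.
have cE (j : 'I_k.+1) : (0 < j)%N ->
    exists2 i : 'I_k.+1, (i < j)%N && e i j & parent_of c j = i.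
  move=> j0; have jk : (j.-1 < k)%N by have := ltn_ord j; lia.
  rewrite /parent_of (nth_map 0%N) ?size_iota // nth_iota // add0n prednK // inord_val.
  case: pickP => [i Pi|no]; first by exists i.
  by have [i ij eij] := ex j j0; have := no i; rewrite /P ij eij.
exists c.
  apply/mem_codes; split=> // j /andP[j0 jk].
  by have [i /andP[ij _] E] := cE (Ordinal (jk : (j < k.+1)%N)) j0; rewrite E.
have half (i j : 'I_k.+1) : (i < j)%N -> e i j = (parent_of c j == i).
  move=> ij; have [i' /andP[i'j ei'j] ->] := cE j (leq_ltn_trans (leq0n _) ij).
  apply/idP/eqP => [eij|/val_inj <- //]; congr val; exact: un ei'j eij.
move=> i j; rewrite /pedge; case: (ltngtP i j) => [ij|ji|/val_inj->] /=.
- by rewrite half // orbF.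
- by rewrite sym half.
- exact: irr.
Qed.

Lemma recursive_trees_codes k :
  perm_eq (enum (recursive_trees k.+1)) [seq graph_of (parent_of c) k | c <- codes k].
Proof.
apply: uniq_perm; first exact: enum_uniq.
  rewrite map_inj_in_uniq ?codes_uniq // => c c'; exact: graph_of_inj.
have ext (e e' : rel 'I_k.+1) : e =2 e' -> e = e'.
  by move=> ee; apply/funext => i; apply/funext => j.
move=> t; rewrite mem_enum inE; apply/asboolP/mapP => [rt|[c /mem_codes[_ pb] ->]].
  have [r0 /parental_pedge[c cc E]] := recursive_parental rt; exists c => //.
  case: t r0 E {rt} => r s /= -> E; rewrite /graph_of; congr (_, _).
  by apply/setP => -[i j]; rewrite inE -E /adj.
rewrite (ext _ _ (@adj_graph_of (parent_of c) k)).
exact/parental_recursive/pedge_parental.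
Qed.

Lemma card_recursive_trees k : #|recursive_trees k.+1| = size (rtrees k).
Proof.
rewrite cardE (perm_size (recursive_trees_codes k)) size_map -!sum1_size.
exact/esym/(sum_rtrees_codes k (fun=> 1%N : nat)).
Qed.

Lemma sum_recursive_trees (R : realType) (alpha : R) k (phi : nat -> R) :
  (\sum_(t in recursive_trees k.+1) phi (eigen_mult alpha t) =
   \sum_(t <- rtrees k) phi (mult alpha t))%R.
Proof.
rewrite sum_rtrees_codes -big_enum (perm_big _ (recursive_trees_codes k)).
rewrite big_map /= [LHS]big_seq [RHS]big_seq; apply: eq_bigr => c /mem_codes[_ pb].
by rewrite eigen_mult_graph_of.
Qed.

End RecursiveTrees.

(** * Additive functionals of random recursive trees *)

Section Expectation.
Variable R : realFieldType.
Implicit Types (F G : btree -> R) (k i j : nat).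

Lemma pascal_sum k (g : nat -> R) :
  \sum_(i < k.+2) 'C(k.+1, i)%:R * g i =
  \sum_(i < k.+1) 'C(k, i)%:R * (g i.+1 + g i).
Proof.
rewrite big_ord_recl bin0 mul1r.
transitivity (g 0%N + \sum_(i < k.+1) ('C(k, i.+1)%:R * g i.+1 + 'C(k, i)%:R * g i.+1)).
  by congr (_ + _); apply: eq_bigr => i _; rewrite lift0 binS natrD mulrDl.
transitivity (\sum_(i < k.+1) ('C(k, i)%:R * g i.+1 + 'C(k, i)%:R * g i)); last first.
  by apply: eq_bigr => i _; rewrite mulrDr.
rewrite !big_split /= addrA [RHS]addrC; congr (_ + _).
have -> : \sum_(i < k.+1) 'C(k, i)%:R * g i = \sum_(i < k.+2) 'C(k, i)%:R * g i.
  by rewrite [RHS]big_ord_recr /= bin_small // mul0r addr0.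
rewrite [RHS]big_ord_recl bin0 mul1r; congr (_ + _).
Qed.

(** After the first edge, each of the [k] further vertices falls on one of its two sides, and the
    binomial coefficient counts the interleavings of the two histories. *)
Lemma sum_rtrees_Node k F :
  \sum_(t <- rtrees k.+1) F t = \sum_(i < k.+1) 'C(k, i)%:R *
     (\sum_(a <- rtrees i) \sum_(b <- rtrees (k - i)) F (Node a b)).
Proof.
elim: k F => [|k IH] F; first by rewrite big_ord1 bin0 mul1r subn0 /= !big_seq1.
rewrite sum_rtreesS IH.
pose S i := \sum_(a <- rtrees i) \sum_(b <- rtrees (k.+1 - i)) F (Node a b).
rewrite (pascal_sum k S); apply: eq_bigr => i _; congr (_ * _).
have ik : (i <= k)%N by rewrite -ltnS.
rewrite /S subSS (subSn ik) sum_rtreesS -big_split /=; apply: eq_bigr => a _.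
rewrite sum_rtreesS exchange_big /= -big_split /=; apply: eq_bigr => b _.
by rewrite big_cat !big_map.
Qed.

Lemma rtrees_nvert k F G : (forall t, nvert t = k.+1 -> F t = G t) ->
  \sum_(t <- rtrees k) F t = \sum_(t <- rtrees k) G t.
Proof.
move=> FG; rewrite !sum_rtrees_codes [LHS]big_seq [RHS]big_seq; apply: eq_bigr => c.
by move=> /mem_codes[_ pb]; apply: FG; rewrite nvert_ltree_of.
Qed.

Definition gmean k F : R := (\sum_(t <- rtrees k) F t) / k`!%:R.

Lemma fact_neq0 k : k`!%:R != 0 :> R.
Proof. by rewrite pnatr_eq0 -lt0n fact_gt0. Qed.

Lemma gmean0 F : gmean 0 F = F Leaf.
Proof. by rewrite /gmean big_seq1 fact0 divr1. Qed.

(** Since ['C(k, i) i! (k - i)! = k!], the size of the first side is uniform and, given the sizes,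
    the two sides are independent. *)
Lemma gmeanS k F : gmean k.+1 F =
  k.+1%:R^-1 * \sum_(i < k.+1) gmean i (fun a => gmean (k - i) (fun b => F (Node a b))).
Proof.
rewrite /gmean sum_rtrees_Node mulr_suml mulr_sumr; apply: eq_bigr => i _.
have ik : (i <= k)%N by rewrite -ltnS.
have := fact_neq0 i; have := fact_neq0 (k - i).
have : 'C(k, i)%:R != 0 :> R by rewrite pnatr_eq0 -lt0n bin_gt0.
rewrite -mulr_suml factS -(bin_fact ik) !natrM.
have : k.+1%:R != 0 :> R by rewrite pnatr_eq0.
move: (k.+1%:R) ('C(k, i)%:R) (i`!%:R) ((k - i)`!%:R) (\sum_(a <- _) _).
by move=> n x y z S n0 x0 z0 y0; field; rewrite n0 x0 y0 z0.
Qed.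

Lemma eq_gmean k F G : (forall t, nvert t = k.+1 -> F t = G t) -> gmean k F = gmean k G.
Proof. by move=> FG; rewrite /gmean (rtrees_nvert FG). Qed.

Lemma gmeanD k F G : gmean k (fun t => F t + G t) = gmean k F + gmean k G.
Proof. by rewrite /gmean big_split mulrDl. Qed.

Lemma gmeanZ k c F : gmean k (fun t => c * F t) = c * gmean k F.
Proof. by rewrite /gmean -mulr_sumr mulrA. Qed.

Lemma gmeanN k F : gmean k (fun t => - F t) = - gmean k F.
Proof. by rewrite /gmean sumrN mulNr. Qed.

Lemma gmean_const k c : gmean k (fun=> c) = c.
Proof.
elim/ltn_ind: k => -[|k] IH; first by rewrite gmean0.
rewrite gmeanS; under eq_bigr => i _.
  rewrite (_ : gmean i _ = c); last first.
    by rewrite -[RHS](IH i (ltn_ord i)); apply: eq_gmean => a _; apply: IH; rewrite ltnS leq_subr.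
  over.
by rewrite sumr_const card_ord -[c *+ _]mulr_natl mulKf // pnatr_eq0.
Qed.

Lemma ler_gmean k F G : (forall t, nvert t = k.+1 -> F t <= G t) -> gmean k F <= gmean k G.
Proof.
move=> FG; rewrite /gmean ler_wpM2r ?invr_ge0 ?ler0n // !sum_rtrees_codes.
rewrite [leLHS]big_seq [leRHS]big_seq; apply: ler_sum => c /mem_codes[_ pb].
by apply: FG; rewrite nvert_ltree_of.
Qed.

Lemma gmean_ge0 k F : (forall t, nvert t = k.+1 -> 0 <= F t) -> 0 <= gmean k F.
Proof. by move=> F0; rewrite -(gmean_const k 0); apply: ler_gmean. Qed.

Lemma ler_norm_gmean k F : `|gmean k F| <= gmean k (fun t => `|F t|).
Proof.
by rewrite ler_norml -gmeanN; apply/andP; split; apply: ler_gmean => t _;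
  rewrite ?ler_norm // lerNl -normrN ler_norm.
Qed.

Lemma size_rtrees k : (size (rtrees k))%:R = k`!%:R :> R.
Proof.
have := gmean_const k 1; rewrite /gmean => /(canRL (mulfVK (fact_neq0 k))).
by rewrite mul1r => <-; rewrite -sum1_size natr_sum.
Qed.

Definition toll F t : R :=
  match t with Leaf => F Leaf | Node a b => F (Node a b) - F a - F b end.

Lemma ord_sum_rev k (g : nat -> R) : \sum_(i < k.+1) g (k - i)%N = \sum_(i < k.+1) g i.
Proof.
rewrite (reindex_inj rev_ord_inj) /=; apply: eq_bigr => i _; congr g.
by have := ltn_ord i; lia.
Qed.

Lemma gmean_Node_split i j (F : btree -> R) (G : btree -> btree -> R) :
  gmean i (fun a => gmean j (fun b => F a + (F b + G a b))) =
  gmean i F + (gmean j F + gmean i (fun a => gmean j (G a))).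
Proof.
rewrite -(gmean_const i (gmean j F)) -!gmeanD; apply: eq_gmean => a _.
by rewrite !gmeanD gmean_const.
Qed.

(** Both sides contribute the same sum by the symmetry [i |-> k - 1 - i], whence the factor [2]. *)
Lemma gmean_toll k F : gmean k F = 2 / k%:R * (\sum_(i < k) gmean i F) + gmean k (toll F).
Proof.
case: k => [|k]; first by rewrite big_ord0 mulr0 add0r !gmean0.
rewrite [gmean _ (toll F)]gmeanS [gmean _ F]gmeanS [2 / _]mulrC -mulrA -mulrDr; congr (_ * _).
rewrite mulr_natl mulr2n -{2}(ord_sum_rev k (fun i => gmean i F)) -!big_split /=.
apply: eq_bigr => i _; rewrite -addrA -gmean_Node_split.
by apply: eq_gmean => a _; apply: eq_gmean => b _; ring.
Qed.

(** For [k > 0] the partial sums satisfy [S (k + 1) = (k + 2) / k * S k + b k], so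
    [S k / (k (k + 1))] telescopes. *)
Lemma linear_recurrence (x b : nat -> R) :
  (forall k, x k = 2 / k%:R * (\sum_(i < k) x i) + b k) ->
  forall k, x k = b k + k.+1%:R * \sum_(j < k) (2 * b j / (j.+1%:R * j.+2%:R)).
Proof.
move=> xE.
have S k : \sum_(i < k) x i =
    k%:R * k.+1%:R / 2 * \sum_(j < k) (2 * b j / (j.+1%:R * j.+2%:R)).
  elim: k => [|k IH]; first by rewrite !big_ord0 mulr0.
  have [->|k0] := eqVneq k 0%N.
    by rewrite !big_ord_recr !big_ord0 /= xE big_ord0 mulr0 !add0r; field.
  rewrite !big_ord_recr /= xE IH; move: (\sum_(j < k) _) => s.
  have k0' : k%:R != 0 :> R by rewrite pnatr_eq0.
  rewrite -[k.+2]addn2 -[k.+1]addn1 !natrD; field.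
  by rewrite -natrD natr1 !pnatr_eq0 k0 addn2.
move=> k; rewrite xE S addrC; congr (_ + _).
have [->|k0] := eqVneq k 0%N; first by rewrite !big_ord0 !mulr0.
have k0' : k%:R != 0 :> R by rewrite pnatr_eq0.
by field.
Qed.

End Expectation.

(** * Convergence of the series in the solution of the recurrence *)

Section Limits.
Variable R : realType.
Implicit Types (u t b x : nat -> R).

(** The partial sums plus [u] decrease and the partial sums minus [u] increase, so they enclose the
    limit. *)
Lemma dominated_sum_cvg u t : (forall j, `|t j| <= u j - u j.+1) ->
  u @ \oo --> (0 : R) -> exists2 l : R,
   (fun n => \sum_(j < n) t j) @ \oo --> l &
   forall n, `|\sum_(j < n) t j - l| <= u n.
Proof.
move=> tu u0; pose s n := \sum_(j < n) t j.
have sS n : s n.+1 = s n + t n by rewrite /s big_ord_recr.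
have tub n : t n <= u n - u n.+1 /\ - (u n - u n.+1) <= t n.
  by have := tu n; rewrite ler_norml => /andP[].
have dec : nonincreasing_seq (fun n => s n + u n).
  by apply/nonincreasing_seqP => n; rewrite sS; have [] := tub n; lra.
have inc : nondecreasing_seq (fun n => s n - u n).
  by apply/nondecreasing_seqP => n; rewrite sS; have [] := tub n; lra.
have udec : nonincreasing_seq u.
  by apply/nonincreasing_seqP => n; have [] := tub n; lra.
have uge0 n : 0 <= u n.
  have := nonincreasing_cvgn_ge udec (cvgP _ u0) n.
  by rewrite (cvg_lim _ u0).
have lb : has_lbound (range (fun n => s n + u n)).
  exists (s 0%N - u 0%N) => _ [n _ <-].
  by have := inc _ _ (leq0n n); have := uge0 n; rewrite /=; lra.
have cv := nonincreasing_is_cvgn dec lb; set l := lim _ in cv.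
have sl : s @ \oo --> l.
  have -> : s = (fun n => (s n + u n) - u n) by apply/funext => n; rewrite addrK.
  by rewrite -[l]subr0; apply: cvgB.
exists l => // n; rewrite -/(s n) ler_norml; apply/andP; split.
  have := nonincreasing_cvgn_ge dec (cvgP _ cv) n; rewrite -/l /=; lra.
have cv' : (fun n => s n - u n) @ \oo --> l by rewrite -[l]subr0; apply: cvgB.
have := nondecreasing_cvgn_le inc (cvgP _ cv') n; rewrite (cvg_lim _ cv') //=; lra.
Qed.

Lemma cvg_cst_div_sqrt (c : R) : (fun n => c / Num.sqrt n.+1%:R) @ \oo --> (0 : R).
Proof.
rewrite -[0](mulr0 c); apply: cvgM; first exact: cvg_cst.
have -> : (fun n => (Num.sqrt n.+1%:R)^-1) = Num.sqrt \o (@harmonic R).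
  by apply/funext => n /=; rewrite /harmonic /= sqrtrV.
rewrite -[0](sqrtr0 R); apply: continuous_cvg; first exact: sqrt_continuous.
exact: cvg_harmonic.
Qed.

Definition recsum b n : R := \sum_(j < n) (2 * b j / (j.+1%:R * j.+2%:R)).

Lemma recsum_bounded b (C : R) : (forall j, `|b j| <= C) ->
  exists2 l : R, recsum b @ \oo --> l & forall n, `|recsum b n - l| <= 2 * C / n.+1%:R.
Proof.
move=> bC; apply: (@dominated_sum_cvg (fun n => 2 * C / n.+1%:R)
  (fun j => 2 * b j / (j.+1%:R * j.+2%:R))) => [j|]; last first.
  by rewrite -[0](mulr0 (2 * C)); apply: cvgM; [exact: cvg_cst|exact: cvg_harmonic].
have j1 : 0 < j.+1%:R :> R by rewrite ltr0n.
have -> : 2 * C / j.+1%:R - 2 * C / j.+2%:R = 2 * C / (j.+1%:R * j.+2%:R) :> R.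
  by rewrite -[j.+2]addn1 natrD; field; by rewrite !nat1r ?natr1 -?natrD !pnatr_eq0.
rewrite !normrM normfV ger0_norm // [X in _ / X]ger0_norm ?mulr_ge0 //.
by rewrite ler_wpM2r ?invr_ge0 ?mulr_ge0 // ler_wpM2l.
Qed.

(** With [p], [q] the square roots of [j + 1], [j + 2], one has [1 / p - 1 / q = 1 / (p q (p + q))
    >= 1 / (2 p q^2)]. This dominates the terms by the differences of [4 C / sqrt (j + 1)]. *)
Lemma recsum_sqrt b (C : R) : (forall j, `|b j| <= C * Num.sqrt j.+1%:R) ->
  exists2 l : R, recsum b @ \oo --> l &
    forall n, `|recsum b n - l| <= 4 * C / Num.sqrt n.+1%:R.
Proof.
move=> bC; apply: (@dominated_sum_cvg (fun n => 4 * C / Num.sqrt n.+1%:R)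
  (fun j => 2 * b j / (j.+1%:R * j.+2%:R))) => [j|]; last exact: cvg_cst_div_sqrt.
have C0 : 0 <= C by have := bC 0%N; rewrite sqrtr1 mulr1; apply: le_trans.
set p := Num.sqrt j.+1%:R; set q := Num.sqrt j.+2%:R.
have p0 : 0 < p by rewrite sqrtr_gt0 ltr0n.
have q0 : 0 < q by rewrite sqrtr_gt0 ltr0n.
have pp : j.+1%:R = p ^+ 2 by rewrite sqr_sqrtr.
have qq : j.+2%:R = q ^+ 2 by rewrite sqr_sqrtr.
have qp1 : q ^+ 2 = p ^+ 2 + 1 by rewrite -pp -qq natr1.
have pq : p <= q by rewrite ler_sqrt // ler_nat.
rewrite !normrM normfV ger0_norm // [X in _ / X]ger0_norm ?mulr_ge0 // pp qq.
apply: le_trans (_ : 2 * (C * p) / (p ^+ 2 * q ^+ 2) <= _).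
  by apply: ler_wpM2r; [rewrite invr_ge0 mulr_ge0 // sqr_ge0 | apply: ler_wpM2l => //; exact: bC].
have -> : 2 * (C * p) / (p ^+ 2 * q ^+ 2) = C * (2 / (p * q ^+ 2)).
  by field; rewrite !gt_eqF.
have -> : 4 * C / p - 4 * C / q = C * (4 / p - 4 / q).
  by field; rewrite !gt_eqF.
rewrite ler_wpM2l //.
have -> : 4 / p - 4 / q = 4 / (p * q * (q + p)).
  have E : (q - p) * (q + p) = 1 by rewrite -subr_sqr qp1; ring.
  have s0 : q + p != 0 by rewrite gt_eqF // addr_gt0.
  have -> : 4 / p - 4 / q = 4 * ((q - p) * (q + p)) / (p * q * (q + p)).
    by field; rewrite s0 !gt_eqF.
  by rewrite E mulr1.
have H : 0 < p * q * (q + p) by rewrite !mulr_gt0 // addr_gt0.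
rewrite ler_pdivrMr; last by rewrite mulr_gt0 // exprn_gt0.
rewrite mulrAC ler_pdivlMr //.
suff : p * q * (q + p) <= 2 * (p * q ^+ 2) by nra.
have : p * q * p <= p * q * q by rewrite ler_wpM2l // mulr_ge0 // ltW.
nra.
Qed.

End Limits.

(** * First and second moments of functionals with bounded toll *)

Section BoundedToll.
Variable R : realType.
Implicit Types (X Y : btree -> R) (x : nat -> R) (k : nat).

Lemma sqrt_succ_ge1 k : 1 <= Num.sqrt k.+1%:R :> R.
Proof. by rewrite -{1}(sqrtr1 R) ler_wsqrtr // ler1n. Qed.

Lemma cvg_div_succ_of_sqrt (b : nat -> R) (C : R) : (forall j, `|b j| <= C * Num.sqrt j.+1%:R) ->
  (fun k => b k / k.+1%:R) @ \oo --> (0 : R).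
Proof.
move=> bC; have lim := cvg_cst_div_sqrt C.
have limN : (fun n => - (C / Num.sqrt n.+1%:R)) @ \oo --> (0 : R).
  by rewrite -oppr0; apply: cvgN.
apply: (squeeze_cvgr _ limN lim); near=> k.
rewrite -ler_norml normrM normfV (ger0_norm (ler0n _ _)) ler_pdivrMr ?ltr0n //.
apply: le_trans (bC k) _.
have p0 : 0 < Num.sqrt k.+1%:R :> R by rewrite sqrtr_gt0 ltr0n.
by rewrite -[X in _ <= _ * X](sqr_sqrtr (ler0n R k.+1)) expr2 mulrA divfK // gt_eqF.
Unshelve. all: by end_near. Qed.

Lemma linear_recurrence_cvg x (b : nat -> R) (C : R) :
  (forall k, x k = 2 / k%:R * (\sum_(i < k) x i) + b k) ->
  (forall j, `|b j| <= C * Num.sqrt j.+1%:R) ->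
  exists2 l : R, (fun k => x k / k.+1%:R) @ \oo --> l & recsum b @ \oo --> l.
Proof.
move=> xE bC; have [l cl _] := recsum_sqrt bC; exists l => //.
have -> : (fun k => x k / k.+1%:R) = (fun k => b k / k.+1%:R + recsum b k).
  apply/funext => k; rewrite (linear_recurrence xE) mulrDl; congr (_ + _).
  by rewrite mulrAC divff ?mul1r // pnatr_eq0.
by rewrite -[l]add0r; apply: cvgD => //; apply: cvg_div_succ_of_sqrt bC.
Qed.

(** The bounded error, stronger than the limit, ensures that subtracting [mu * nvert] leaves a
    bounded mean. It is [C] from the last toll plus [2 C] from the tail of the series. *)
Lemma bounded_toll_mean X (C : R) : (forall t, `|toll X t| <= C) ->
  exists2 mu : R, (fun k => gmean k X / k.+1%:R) @ \oo --> mu &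
    forall k, `|gmean k X - mu * k.+1%:R| <= 3 * C.
Proof.
move=> XC; pose b k := gmean k (toll X).
have bC j : `|b j| <= C.
  apply: le_trans (ler_norm_gmean _ _) _; rewrite -[C](gmean_const j); exact: ler_gmean.
have C0 : 0 <= C by apply: le_trans (bC 0%N).
have bC' j : `|b j| <= C * Num.sqrt j.+1%:R.
  apply: le_trans (bC j) _; by rewrite ler_peMr // sqrt_succ_ge1.
have xE k := gmean_toll k X.
have [mu cv cr] := linear_recurrence_cvg xE bC'; exists mu => // k.
have [l cl Hl] := recsum_bounded bC.
have El : l = mu by rewrite -(cvg_lim _ cl) // (cvg_lim _ cr).
rewrite (linear_recurrence xE) -/(recsum b k) -El.
have -> : gmean k (toll X) + k.+1%:R * recsum b k - l * k.+1%:R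
  = b k + k.+1%:R * (recsum b k - l) by rewrite /b; ring.
have -> : 3 * C = C + k.+1%:R * (2 * C / k.+1%:R).
  by rewrite mulrCA divff ?mulr1 ?pnatr_eq0 //; ring.
apply: le_trans (ler_normD _ _) _; apply: lerD; first exact: bC.
by rewrite normrM ger0_norm // ler_wpM2l.
Qed.

(* The free parameter [L] makes the coefficient of [m] as small as needed to
   close the induction [gmean k (Y ^+ 2) <= m (k + 1)] of [bounded_toll_sqr]. *)
Lemma toll_sqr_bound Y (C m L : R) k : 0 < L -> 0 <= m ->
  (forall t, `|toll Y t| <= C) -> (forall i, `|gmean i Y| <= C) ->
  (forall i, (i < k)%N -> gmean i (fun t => Y t ^+ 2) <= m * i.+1%:R) ->
  `|gmean k (toll (fun t => Y t ^+ 2))| <=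
     (4 * C ^+ 2 + 2 * C * L + 2 * C * (m / L)) * Num.sqrt k.+1%:R.
Proof.
move=> L0 m0 YC eC IH.
have C0 : 0 <= C by apply: le_trans (YC Leaf).
have mL0 : 0 <= m / L by rewrite divr_ge0 // ltW.
set Kc := _ + _ + _; have Kc0 : 0 <= Kc.
  have h1 : 0 <= 2 * C * L by rewrite !mulr_ge0 // ltW.
  have h2 : 0 <= 2 * C * (m / L) by rewrite mulr_ge0 // mulr_ge0.
  by have := sqr_ge0 C; rewrite /Kc; lra.
case: k IH => [|k] IH.
  rewrite gmean0 sqrtr1 mulr1 /= normrX.
  have := YC Leaf; rewrite /= => h.
  have : `|Y Leaf| ^+ 2 <= C ^+ 2 by rewrite lerXn2r ?nnegrE.
  have : 0 <= 2 * C * L by rewrite !mulr_ge0 // ltW.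
  have : 0 <= 2 * C * (m / L) by rewrite mulr_ge0 // mulr_ge0.
  have := sqr_ge0 C; rewrite /Kc; lra.
set r := Num.sqrt _; have r0 : 0 < r by rewrite sqrtr_gt0 ltr0n.
have r1 : 1 <= r by apply: sqrt_succ_ge1.
have rr : k.+2%:R = r ^+ 2 by rewrite sqr_sqrtr.
have absY i : (i < k.+1)%N -> gmean i (fun t => `|Y t|) <= r * (m / L + L) / 2.
  (* AM-GM with weight [L * r]. *)
  move=> ik; have A0 : 0 < L * r by rewrite mulr_gt0.
  apply: le_trans (_ : gmean i (fun t => (2 * (L * r))^-1 * Y t ^+ 2 + L * r / 2) <= _).
    apply: ler_gmean => t _; rewrite -real_normK ?num_real //.
    move: A0 `|Y t| => /[swap] y; move: (L * r) => A A0.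
    have -> : (2 * A)^-1 * y ^+ 2 + A / 2 = y + (y - A) ^+ 2 / (2 * A).
      by field; rewrite gt_eqF.
    by rewrite lerDl divr_ge0 ?sqr_ge0 // mulr_ge0 // ltW.
  rewrite gmeanD gmeanZ gmean_const.
  apply: le_trans (_ : (2 * (L * r))^-1 * (m * r ^+ 2) + L * r / 2 <= _).
    rewrite lerD2r; apply: ler_wpM2l; first by rewrite invr_ge0 mulr_ge0 // ltW.
    apply: le_trans (IH i ik) _; rewrite -rr ler_wpM2l // ler_nat; lia.
  rewrite le_eqVlt; apply/orP; left; apply/eqP; field.
  by rewrite !gt_eqF.
rewrite gmeanS normrM normfV normr_nat ler_pdivrMl ?ltr0n //.
apply: le_trans (ler_norm_sum _ _ _) _.
apply: le_trans (_ : \sum_(i < k.+1) (Kc * r) <= _); last first.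
  by rewrite sumr_const card_ord -[_ *+ k.+1]mulr_natl.
apply: ler_sum => i _; have ik := ltn_ord i.
set j := (k - i)%N; have jk : (j < k.+1)%N by rewrite ltnS leq_subr.
pose g a b := toll Y (Node a b).
have gC a b : `|g a b| <= C by apply: YC.
(* As [Y (Node a b) = Y a + Y b + g a b], the only quadratic term in the toll of [Y ^+ 2] is
   [2 Y a Y b], whose mean is bounded by independence. *)
have -> : gmean i (fun a => gmean j (fun b => toll (fun t => Y t ^+ 2) (Node a b))) =
   2 * (gmean i Y * gmean j Y) +
   gmean i (fun a => gmean j (fun b => 2 * g a b * (Y a + Y b) + g a b ^+ 2)).
  have -> : 2 * (gmean i Y * gmean j Y) = gmean i (fun a => gmean j (fun b => 2 * Y a * Y b)).
    transitivity (gmean i (fun a => 2 * gmean j Y * Y a)); first by rewrite gmeanZ; ring.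
    by apply: eq_gmean => a _; rewrite gmeanZ; ring.
  rewrite -gmeanD; apply: eq_gmean => a _; rewrite -gmeanD; apply: eq_gmean => b _.
  by rewrite /g /=; ring.
apply: le_trans (ler_normD _ _) _.
have h1 : `|2 * (gmean i Y * gmean j Y)| <= 2 * C ^+ 2.
  rewrite normrM ger0_norm // ler_wpM2l // normrM expr2.
  by rewrite ler_pM.
have h2 : `|gmean i (fun a => gmean j (fun b => 2 * g a b * (Y a + Y b) + g a b ^+ 2))| <=
   2 * C * (gmean i (fun t => `|Y t|) + gmean j (fun t => `|Y t|)) + C ^+ 2.
  have -> : 2 * C * (gmean i (fun t => `|Y t|) + gmean j (fun t => `|Y t|)) + C ^+ 2
    = gmean i (fun a => gmean j (fun b => 2 * C * (`|Y a| + `|Y b|) + C ^+ 2)).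
    transitivity (gmean i (fun a => 2 * C * `|Y a| + (2 * C * gmean j (fun t => `|Y t|) + C ^+ 2))).
      by rewrite gmeanD gmeanZ gmean_const; ring.
    by apply: eq_gmean => a _; rewrite gmeanD gmeanZ gmeanD !gmean_const; ring.
  apply: le_trans (ler_norm_gmean _ _) _; apply: ler_gmean => a _.
  apply: le_trans (ler_norm_gmean _ _) _; apply: ler_gmean => b _.
  apply: le_trans (ler_normD _ _) _; apply: lerD; last first.
    by rewrite normrX lerXn2r ?nnegrE.
  rewrite !normrM ger0_norm //; apply: ler_pM; rewrite ?mulr_ge0 // ?ler_wpM2l //.
  exact: ler_normD.
have := absY i ik; have := absY j jk.
move: (gmean i (fun t => `|Y t|)) (gmean j _) h2 => u v h2 hv hu.
have h3 : 2 * C * (u + v) <= 2 * C * (r * (m / L + L)).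
  by rewrite ler_wpM2l ?mulr_ge0 //; lra.
have h4 : C ^+ 2 <= C ^+ 2 * r by rewrite ler_peMr ?sqr_ge0.
have -> : Kc * r = 4 * (C ^+ 2 * r) + 2 * C * (r * (m / L + L)) by rewrite /Kc; ring.
have := sqr_ge0 C; lra.
Qed.

Lemma bounded_toll_sqr Y (C : R) :
  (forall t, `|toll Y t| <= C) -> (forall i, `|gmean i Y| <= C) ->
  exists l : R, (fun k => gmean k (fun t => Y t ^+ 2) / k.+1%:R) @ \oo --> l.
Proof.
move=> YC eC; have C0 : 0 <= C by apply: le_trans (YC Leaf).
(* The induction below yields the bound [9 Kc]. Here [9 (4 C^2 + 2 C L) = m / 2], and [L >= 36 C]
   gives [18 C m / L <= m / 2], so [9 Kc <= m]. *)
pose L := 36 * C + 1; have L0 : 0 < L by rewrite /L; lra.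
pose m := 18 * (4 * C ^+ 2 + 2 * C * L).
have m0 : 0 <= m.
  have h1 : 0 <= 2 * C * L by rewrite !mulr_ge0 // ltW.
  by have := sqr_ge0 C; rewrite /m; lra.
pose Kc := 4 * C ^+ 2 + 2 * C * L + 2 * C * (m / L).
have Kc_m : 9 * Kc <= m.
  have H : 36 * C * (m / L) <= m.
    by rewrite mulrA ler_pdivrMr // [leLHS]mulrC ler_wpM2l // /L; lra.
  have E1 : 4 * C ^+ 2 + 2 * C * L = m / 18 by rewrite /m; field.
  by rewrite /Kc E1; move: (m / L) H => z H; lra.
have Kc0 : 0 <= Kc.
  have h1 : 0 <= 2 * C * L by rewrite !mulr_ge0 // ltW.
  have h2 : 0 <= 2 * C * (m / L).
    by apply: mulr_ge0; [apply: mulr_ge0 | apply: divr_ge0 => //; exact: ltW].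
  by have := sqr_ge0 C; rewrite /Kc; lra.
pose v k := gmean k (fun t => Y t ^+ 2); pose b k := gmean k (toll (fun t => Y t ^+ 2)).
have vE k : v k = 2 / k%:R * (\sum_(i < k) v i) + b k by apply: gmean_toll.
have bK k : (forall i, (i < k)%N -> v i <= m * i.+1%:R) ->
    `|b k| <= Kc * Num.sqrt k.+1%:R by apply: toll_sqr_bound.
have vm k : v k <= m * k.+1%:R.
  elim/ltn_ind: k => k IH.
  have bk := bK k IH.
  (* At this stage the bound on [b] is known only up to [k], while [recsum_sqrt] asks for it
     everywhere. *)
  pose b' j := if (j < k)%N then b j else 0.
  have b'K j : `|b' j| <= Kc * Num.sqrt j.+1%:R.
    rewrite /b'; case: ltnP => jk; last by rewrite normr0 mulr_ge0 ?sqrtr_ge0.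
    by apply: bK => i ij; apply: IH; apply: ltn_trans jk.
  have [l _ Hl] := recsum_sqrt b'K.
  have E1 : recsum b' k = recsum b k.
    by apply: eq_bigr => j _; rewrite /b' ltn_ord.
  (* At [0] the sum is empty, so [l] is at most [4 Kc]; with the error at [k], the sum is at most
     [8 Kc]. *)
  have := Hl 0%N; have := Hl k; rewrite E1 {2}/recsum big_ord0 sub0r normrN sqrtr1 divr1 => H1 H2.
  have s1 : 1 <= Num.sqrt k.+1%:R :> R by apply: sqrt_succ_ge1.
  have H3 : 4 * Kc / Num.sqrt k.+1%:R <= 4 * Kc.
    by rewrite ler_pdivrMr ?(lt_le_trans ltr01) // ler_peMr // mulr_ge0.
  have H4 : recsum b k <= 8 * Kc.
    have := ler_norm (recsum b k - l); have := ler_norm l; lra.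
  rewrite (linear_recurrence vE) -/(recsum b k).
  have H5 : Num.sqrt k.+1%:R <= k.+1%:R :> R.
    by rewrite -[X in _ <= X](sqr_sqrtr (ler0n R k.+1)) expr2 ler_peMr ?sqrtr_ge0.
  have H6 : b k <= Kc * k.+1%:R.
    by apply: le_trans (ler_norm _) _; apply: le_trans bk _; rewrite ler_wpM2l.
  have H7 : k.+1%:R * recsum b k <= k.+1%:R * (8 * Kc) by rewrite ler_wpM2l.
  have H8 : k.+1%:R * (9 * Kc) <= k.+1%:R * m by rewrite ler_wpM2l.
  by lra.
have bK' j : `|b j| <= Kc * Num.sqrt j.+1%:R by apply: bK => i _; apply: vm.
by have [l cl _] := linear_recurrence_cvg vE bK'; exists l.
Qed.

End BoundedToll.

(** * Counting subtrees, and the difference functional for a swap *)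

Section Additive.
Variable R : realType.

Fixpoint addf (z : btree -> R) (t : btree) : R :=
  z t + match t with Leaf => 0 | Node a b => addf z a + addf z b end.

Lemma toll_addf z t : toll (addf z) t = z t.
Proof. by case: t => [|a b] /=; [rewrite addr0 | ring]. Qed.

Lemma addf_small z n t :
  (forall t', (nvert t' < n)%N -> z t' = 0) -> (nvert t < n)%N -> addf z t = 0.
Proof.
move=> z0; elim: t => [|a IHa b IHb] tn /=; first by rewrite z0 // addr0.
have := nvert_gt0 a; have := nvert_gt0 b; move: tn => /= tn a0 b0.
by rewrite z0 // IHa ?IHb ?addr0 //; lia.
Qed.

Definition ind (s t : btree) : R := `[< t = s >]%:R.

Lemma indE s : ind s s = 1.
Proof. by rewrite /ind asboolT. Qed.

Lemma ind_neq s t : nvert t <> nvert s -> ind s t = 0.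
Proof. by move=> ts; rewrite /ind asboolF // => E; apply: ts; rewrite E. Qed.

Lemma mul_ind (phi : btree -> R) s t : phi t * ind s t = phi s * ind s t.
Proof. by rewrite /ind; case: asboolP => [->//|_]; rewrite !mulr0. Qed.

(** [occ] stops at a copy of [s], while [addf] also visits its subtrees; these have fewer vertices
    than [s] and contribute [0]. *)
Lemma occ_addf s t : (occ s t)%:R = addf (ind s) t.
Proof.
elim: t => [|a IHa b IHb] /=; first by rewrite /ind addr0; case: asboolP.
rewrite {1}/ind; case: asboolP => [E|_]; last by rewrite natrD IHa IHb add0r.
have small t : (nvert t < nvert s)%N -> addf (ind s) t = 0.
  by apply: addf_small => t' t's; apply: ind_neq => E'; rewrite E' ltnn in t's.
have := nvert_gt0 a; have := nvert_gt0 b => a0 b0.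
have sab : nvert s = (nvert a + nvert b)%N by rewrite -E.
by rewrite !small ?addr0 //; lia.
Qed.

Lemma gmean_ind_neq k s : nvert s <> k.+1 -> gmean k (ind s) = 0.
Proof.
move=> sk; rewrite -[RHS](gmean_const k 0); apply: eq_gmean => t tk.
by apply: ind_neq; rewrite tk; apply/nesym.
Qed.

Lemma gmean_ind_ge0 k s : 0 <= gmean k (ind s).
Proof. by apply: gmean_ge0 => t _; rewrite /ind ler0n. Qed.

Lemma gmean_ind_gt0 k s : nvert s = k.+1 -> 0 < gmean k (ind s).
Proof.
elim: s k => [|a IHa b IHb] k.
  by case: k => // _; rewrite gmean0 indE.
move=> /= Hk; have a0 := nvert_gt0 a; have b0 := nvert_gt0 b.
case: k Hk => [|k] Hk; first by lia.
have ik : ((nvert a).-1 < k.+1)%N by lia.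
rewrite gmeanS mulr_gt0 ?invr_gt0 ?ltr0n // (bigD1 (Ordinal ik)) //=.
have indN x y : ind (Node a b) (Node x y) = ind a x * ind b y.
  rewrite /ind; case: asboolP => [[-> ->]|ne]; first by rewrite !asboolT // mulr1.
  case: asboolP => [E1|]; last by rewrite mul0r.
  case: asboolP => [E2|]; last by rewrite mulr0.
  by case: ne; rewrite E1 E2.
have EN i j : gmean i (fun x => gmean j (fun y => ind (Node a b) (Node x y))) =
    gmean i (ind a) * gmean j (ind b).
  rewrite mulrC -gmeanZ; apply: eq_gmean => x _; rewrite mulrC -gmeanZ.
  by apply: eq_gmean => y _.
rewrite ltr_pwDl //.
  rewrite EN mulr_gt0 //; first by apply: IHa; lia.
  by apply: IHb; lia.
by apply: sumr_ge0 => i _; rewrite EN mulr_ge0 ?gmean_ind_ge0.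
Qed.

Lemma linear_recurrence_single (x b : nat -> R) s :
  (forall k, x k = 2 / k%:R * (\sum_(i < k) x i) + b k) ->
  (forall k, k != s -> b k = 0) ->
  forall k, (s < k)%N -> x k = k.+1%:R * (2 * b s / (s.+1%:R * s.+2%:R)).
Proof.
move=> xE bs k sk; rewrite (linear_recurrence xE) bs ?gtn_eqF // add0r; congr (_ * _).
rewrite (bigD1 (Ordinal sk)) //= big1 ?addr0 // => j js.
by rewrite bs ?mulr0 ?mul0r.
Qed.

Lemma occ_mean s : exists2 c : R, 0 < c &
  forall k, (nvert s <= k)%N -> gmean k (fun t => (occ s t)%:R) = c * k.+1%:R.
Proof.
have s0 := nvert_gt0 s; set j := (nvert s).-1.
have sj : nvert s = j.+1 by rewrite prednK.
exists (2 * gmean j (ind s) / (j.+1%:R * j.+2%:R)).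
  by apply: divr_gt0; apply: mulr_gt0 => //; rewrite ?ltr0n ?gmean_ind_gt0.
move=> k sk; rewrite mulrC.
apply: (@linear_recurrence_single (fun k => gmean k (fun t => (occ s t)%:R))
   (fun k => gmean k (ind s)) j) => //.
- move=> i; rewrite gmean_toll; congr (_ + _); apply: eq_gmean => t _.
  rewrite -[RHS]toll_addf; congr (toll _ t); apply/funext => u; exact: occ_addf.
- by move=> i ij; apply: gmean_ind_neq; rewrite sj; apply/eqP; rewrite eqSS eq_sym.
- by rewrite -ltnS -sj.
Qed.

Lemma gmean_swap i j (F : btree -> btree -> R) :
  gmean i (fun a => gmean j (F a)) = gmean j (fun b => gmean i (F^~ b)).
Proof.
rewrite /gmean; under eq_bigr do rewrite mulr_suml.
rewrite exchange_big /= !mulr_suml; apply: eq_bigr => b _.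
rewrite mulr_suml mulr_suml mulr_suml; apply: eq_bigr => a _.
by rewrite mulrAC.
Qed.

Section Swap.
Variables (s1 s2 : btree).
Hypothesis s12 : nvert s1 = nvert s2.

Let j := (nvert s1).-1.
Let s1j : nvert s1 = j.+1. Proof. by rewrite prednK // nvert_gt0. Qed.
Let s2j : nvert s2 = j.+1. Proof. by rewrite -s12. Qed.

(* Weighted so that its mean vanishes, hence orthogonal to every function that
   does not distinguish [s1] from [s2]. *)
Definition swap_weight (t : btree) : R :=
  ind s1 t - gmean j (ind s1) / gmean j (ind s2) * ind s2 t.

Let rho : R := gmean j (ind s1) / gmean j (ind s2).

Let gmean_ratio k : gmean k (ind s1) = rho * gmean k (ind s2).
Proof.
have [->|kj] := eqVneq k j.
  by rewrite /rho divfK // gt_eqF // gmean_ind_gt0.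
by rewrite !gmean_ind_neq ?mulr0 // ?s1j ?s2j; apply/eqP; rewrite eqSS eq_sym.
Qed.

Lemma gmean_mul_swap_weight k (phi : btree -> R) :
  gmean k (fun t => phi t * swap_weight t) = (phi s1 - phi s2) * gmean k (ind s1).
Proof.
transitivity (gmean k (fun t => phi s1 * ind s1 t + - (rho * phi s2) * ind s2 t)).
  apply: eq_gmean => t _; rewrite /swap_weight mulrBr mulrCA mul_ind [phi t * _]mul_ind /rho; ring.
by rewrite gmeanD !gmeanZ gmean_ratio; ring.
Qed.

(** At the top the weight is orthogonal to [phi], as [phi s1 = phi s2]. Inside one side, with the
    other side fixed, [phi] is still invariant under swaps, so induction applies. *)
Lemma gmean_mul_addf_swap_weight k (phi : btree -> R) :
  (forall t t', swap s1 s2 t t' -> phi t = phi t') ->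
  gmean k (fun t => phi t * addf swap_weight t) = 0.
Proof.
elim/ltn_ind: k phi => k IH phi inv.
have -> : gmean k (fun t => phi t * addf swap_weight t) =
    gmean k (fun t => phi t * swap_weight t) +
    gmean k (fun t => phi t * (addf swap_weight t - swap_weight t)).
  by rewrite -gmeanD; apply: eq_gmean => t _; ring.
rewrite gmean_mul_swap_weight (inv _ _ (swap_here _ _)) subrr mul0r add0r.
case: k IH => [|k] IH; first by rewrite gmean0 /= addr0 subrr mulr0.
rewrite gmeanS big1 ?mulr0 // => i _.
have ik : (i < k.+1)%N by [].
have jk : (k - i < k.+1)%N by rewrite ltnS leq_subr.
transitivity (gmean i (fun a => gmean (k - i) (fun b => phi (Node a b) * addf swap_weight a)) +
              gmean i (fun a => gmean (k - i) (fun b => phi (Node a b) * addf swap_weight b))).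
  rewrite -gmeanD; apply: eq_gmean => a _; rewrite -gmeanD; apply: eq_gmean => b _ /=; ring.
rewrite gmean_swap -[RHS]addr0; congr (_ + _).
  rewrite -[RHS](gmean_const (k - i) 0); apply: eq_gmean => b _; apply: IH => // a a' sw.
  by apply: inv; apply: swap_l.
rewrite -[RHS](gmean_const i 0); apply: eq_gmean => a _; apply: IH => // b b' sw.
by apply: inv; apply: swap_r.
Qed.

Lemma gmean_addf_swap_weight k : gmean k (addf swap_weight) = 0.
Proof.
rewrite -[RHS](@gmean_mul_addf_swap_weight k (fun=> 1)) //.
by apply: eq_gmean => t _; rewrite mul1r.
Qed.

Let small t : (nvert t < nvert s1)%N -> addf swap_weight t = 0.
Proof.
apply: addf_small => t' t's; rewrite /swap_weight !ind_neq ?mulr0 ?subr0 //; lia.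
Qed.

(** Where the weight at a [Node] is nonzero, both sides are too small to contribute, so the toll of
    the square is [2 Z a Z b] plus the squared weight. The product averages to [0] by
    independence. *)
Lemma gmean_addf_swap_weight_sqr : exists2 q : R, 0 <= q &
  forall k, (nvert s1 <= k)%N -> gmean k (fun t => addf swap_weight t ^+ 2) = q * k.+1%:R.
Proof.
pose b k := gmean k (fun t => swap_weight t ^+ 2).
have b0 k : 0 <= b k by apply: gmean_ge0 => t _; apply: sqr_ge0.
exists (2 * b j / (j.+1%:R * j.+2%:R)).
  by apply: divr_ge0; apply: mulr_ge0; rewrite ?b0 ?ler0n.
move=> k sk; rewrite mulrC.
apply: (@linear_recurrence_single (fun k => gmean k (fun t => addf swap_weight t ^+ 2)) b j) => //.
- move=> i; rewrite gmean_toll; congr (_ + _); rewrite /b.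
  case: i => [|i]; first by rewrite !gmean0 /= addr0.
  rewrite !gmeanS; congr (_ * _); apply: eq_bigr => l _.
  set n := (i - l)%N; pose Z := addf swap_weight.
  transitivity (gmean l (fun a => gmean n (fun b =>
      (2 * Z a) * Z b + swap_weight (Node a b) ^+ 2))).
    apply: eq_gmean => x _; apply: eq_gmean => y _.
    have : swap_weight (Node x y) = 0 \/ Z x = 0 /\ Z y = 0.
      have [E1|ne] := eqVneq (nvert (Node x y)) (nvert s1).
        right; have := nvert_gt0 x; have := nvert_gt0 y; move: E1 => /= E1 ??.
        by rewrite /Z !small // -E1 /=; lia.
      left; rewrite /swap_weight !ind_neq ?mulr0 ?subr0 //; first by rewrite -s12; apply/eqP.
      exact/eqP.
    by rewrite /= -/(Z _) -/(Z _); case=> [->|[-> ->]]; ring.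
  transitivity (gmean l (fun a => 2 * Z a * gmean n Z +
      gmean n (fun b => swap_weight (Node a b) ^+ 2))).
    by apply: eq_gmean => x _; rewrite gmeanD gmeanZ.
  apply: eq_gmean => x _; rewrite [X in _ * X + _]gmean_addf_swap_weight mulr0 add0r //.
- move=> i ij; rewrite /b -[RHS](gmean_const i 0); apply: eq_gmean => t ti.
  rewrite /swap_weight !ind_neq ?mulr0 ?subr0 ?expr0n // ?s1j ?s2j ti;
    by apply/eqP; rewrite eqSS.
- by rewrite -ltnS -s1j.
Qed.

(** In [Y (Node x y) - Y x] the shift [D] cancels when [x] is swapped, so its product with [Z x] has
    mean [0]; likewise for [y]. Only the product of [Y] with the weight remains in the toll. *)
Lemma gmean_mul_addf_swap_weight_shift (Y : btree -> R) (D : R) :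
  (forall t t', swap s1 s2 t t' -> Y t = Y t' + D) ->
  exists2 w : R, 0 < w & forall k, (nvert s1 <= k)%N ->
     gmean k (fun t => Y t * addf swap_weight t) = D * w * k.+1%:R.
Proof.
move=> YD; exists (2 * gmean j (ind s1) / (j.+1%:R * j.+2%:R)).
  by apply: divr_gt0; apply: mulr_gt0 => //; rewrite ?ltr0n ?gmean_ind_gt0.
move=> k sk; pose b k := D * gmean k (ind s1).
have -> : D * (2 * gmean j (ind s1) / (j.+1%:R * j.+2%:R)) * k.+1%:R =
  k.+1%:R * (2 * b j / (j.+1%:R * j.+2%:R)) by rewrite /b; ring.
apply: (@linear_recurrence_single (fun k => gmean k (fun t => Y t * addf swap_weight t)) b j) => //.
- move=> i; rewrite gmean_toll; congr (_ + _); rewrite /b.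
  have -> : D = Y s1 - Y s2 by rewrite (YD _ _ (swap_here _ _)) addrC addKr.
  rewrite -gmean_mul_swap_weight.
  case: i => [|i]; first by rewrite !gmean0 /= addr0.
  rewrite !gmeanS; congr (_ * _); apply: eq_bigr => l _.
  set n := (i - l)%N; pose Z := addf swap_weight.
  pose g x y := Y (Node x y) - Y x; pose h x y := Y (Node x y) - Y y.
  transitivity (gmean l (fun x => gmean n (fun y => Y (Node x y) * swap_weight (Node x y))) +
     (gmean l (fun x => gmean n (fun y => h x y * Z y)) +
      gmean n (fun y => gmean l (fun x => g x y * Z x)))).
    rewrite [gmean n (fun y => gmean l _)]gmean_swap -!gmeanD; apply: eq_gmean => x _.
    rewrite -!gmeanD; apply: eq_gmean => y _.
    by rewrite /= -/(Z _) -/(Z _) /g /h; ring.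
  rewrite [X in _ + (X + _)](_ : _ = 0) ?[X in _ + (_ + X)](_ : _ = 0) ?addr0 //.
    rewrite -[RHS](gmean_const n 0); apply: eq_gmean => y _.
    apply: gmean_mul_addf_swap_weight => x x' sw.
    by rewrite /g (YD _ _ sw) (YD _ _ (swap_l y sw)); ring.
  rewrite -[RHS](gmean_const l 0); apply: eq_gmean => x _.
  apply: gmean_mul_addf_swap_weight => y y' sw.
  by rewrite /h (YD _ _ sw) (YD _ _ (swap_r x sw)); ring.
- by move=> i ij; rewrite /b gmean_ind_neq ?mulr0 // s1j; apply/eqP; rewrite eqSS eq_sym.
- by rewrite -ltnS -s1j.
Qed.

End Swap.
End Additive.

(** * Mean and variance of the multiplicity *)

Definition attach n (t s : btree) : btree := iter n (Node^~ t) s.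

Lemma nvert_attach n t s : nvert (attach n t s) = (nvert s + n * nvert t)%N.
Proof. by elim: n => [|n /= ->]; rewrite ?addn0 // mulSn; lia. Qed.

Lemma killed_attach (K : fieldType) (lam : K) n t s :
  killed lam s -> killed lam (attach n t s).
Proof. by move=> ks; elim: n => // n; apply: killed_Node. Qed.

Lemma mult_attach (K : fieldType) (lam : K) n t s : killed lam s ->
  mult lam (attach n t s) = (mult lam s + n * mult lam t)%N.
Proof.
move=> ks; elim: n => [|n IH]; first by rewrite addn0.
rewrite -[attach _ _ _]/(Node (attach n t s) t) mult_killed_Node; last exact: killed_attach.
by rewrite IH mulSn; lia.
Qed.

(** To one killed tree, attach [nvert t1] copies of [t0] or [nvert t0] copies of [t1]. The vertex
    counts agree, and multiplicities add up, with that of [t0] positive and that of [t1] zero. *)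
Lemma killed_swap_pair (K : fieldType) (lam : K) t0 : rooted_eigen lam t0 ->
  exists s1 s2, [/\ killed lam s1, killed lam s2, nvert s1 = nvert s2 &
    (mult lam s2 < mult lam s1)%N].
Proof.
move=> et0; have [t1 m1] := mult_eq0_exists lam.
have ks := rooted_eigen_killed Leaf et0.
exists (attach (nvert t1) t0 (Node Leaf t0)), (attach (nvert t0) t1 (Node Leaf t0)).
split; rewrite ?nvert_attach ?mult_attach // ?(mulnC (nvert t1)) ?m1 ?muln0 //.
- exact: killed_attach.
- exact: killed_attach.
- by rewrite ltn_add2l muln_gt0 rooted_eigen_mult // nvert_gt0.
Qed.

Section MainProof.
Variables (R : realType) (alpha : R).

Let X (t : btree) : R := (mult alpha t)%:R.

Lemma unif_mean_mult k (phi : nat -> R) :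
  unif_mean (recursive_trees k.+1) (fun t => phi (eigen_mult alpha t)) =
  gmean k (fun t => phi (mult alpha t)).
Proof.
by rewrite /unif_mean /gmean sum_recursive_trees card_recursive_trees size_rtrees.
Qed.

Lemma mean_mult_recE k : mean_mult_rec alpha k.+1 = gmean k X.
Proof. exact: (unif_mean_mult k (fun n => n%:R)). Qed.

Lemma var_mult_recE k :
  var_mult_rec alpha k.+1 = gmean k (fun t => (X t - gmean k X) ^+ 2).
Proof.
rewrite /var_mult_rec /unif_var (unif_mean_mult k (fun n => n%:R)).
exact: (unif_mean_mult k (fun n => (n%:R - gmean k X) ^+ 2)).
Qed.

Lemma toll_mult_bound t : `|toll X t| <= 2.
Proof.
case: t => [|a b] /=.
  have : (mult alpha Leaf <= 1)%N by rewrite /mult leq_subr.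
  by rewrite /X ger0_norm // -[2]/(2%:R) ler_nat => h; apply: leq_trans h _.
have [h1 h2] := mult_Node_bounds alpha a b.
move: h1 h2; rewrite -!(ler_nat R) !natrD -/(X _) -/(X a) -/(X b) => h1 h2.
by rewrite ler_norml; apply/andP; split; lra.
Qed.

Lemma var_shift k (mu : R) : let Y t := X t - mu * (nvert t)%:R in
  var_mult_rec alpha k.+1 = gmean k (fun t => (Y t - gmean k Y) ^+ 2).
Proof.
move=> Y; have eY : gmean k Y = gmean k X - mu * k.+1%:R.
  rewrite -(gmean_const k (mu * k.+1%:R)) -gmeanN -gmeanD; apply: eq_gmean => t tk.
  by rewrite /Y tk.
rewrite var_mult_recE; apply: eq_gmean => t tk.
by rewrite eY /Y tk; congr (_ ^+ 2); ring.
Qed.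

End MainProof.

Theorem mainTheorem2 (R : realType) (alpha : R)
    (halpha : totally_real_algebraic_integer alpha) :
  exists mu sigma2 : R,
    [/\ (fun n : nat => mean_mult_rec alpha n / n%:R) @ \oo --> mu,
        (fun n : nat => var_mult_rec alpha n / n%:R) @ \oo --> sigma2,
        0 < mu &
        0 < sigma2].
Proof.
have [t0 et0] := rooted_eigen_exists halpha.
pose X t : R := (mult alpha t)%:R.
have [mu cmu eX] := bounded_toll_mean (toll_mult_bound alpha).
(* [nvert] is additive and constant at each size: [Y] has the variance of [X], but a bounded
   mean. *)
pose Y t := X t - mu * (nvert t)%:R.
have eY k : gmean k Y = gmean k X - mu * k.+1%:R.
  rewrite -(gmean_const k (mu * k.+1%:R)) -gmeanN -gmeanD; apply: eq_gmean => t tk.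
  by rewrite /Y tk.
(* [6] is three times the toll bound [2], from [bounded_toll_mean]; the other term covers the toll
   of [Y] at [Leaf]. *)
pose C := 6 + `|mu|.
have YC t : `|toll Y t| <= C.
  have := toll_mult_bound alpha t; case: t => [|a b].
    rewrite /= /Y /= mulr1 => h; apply: le_trans (ler_normB _ _) _.
    by rewrite /C lerD2r; apply: le_trans h _; rewrite ler_nat.
  have -> : toll Y (Node a b) = toll X (Node a b) by rewrite /Y /= natrD; ring.
  by move=> h; have := normr_ge0 mu; rewrite /C; move: h; rewrite -/X; lra.
have eYC k : `|gmean k Y| <= C.
  by rewrite eY; have := eX k; have := normr_ge0 mu; rewrite /C -/X; lra.
have [s2 cs2] := bounded_toll_sqr YC eYC.
have varY k : var_mult_rec alpha k.+1 = gmean k (fun t => (Y t - gmean k Y) ^+ 2).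
  exact: var_shift.
have varE k : var_mult_rec alpha k.+1 = gmean k (fun t => Y t ^+ 2) - (gmean k Y) ^+ 2.
  rewrite varY.
  transitivity (gmean k (fun t => Y t ^+ 2 + (- (2 * gmean k Y) * Y t + (gmean k Y) ^+ 2))).
    by apply: eq_gmean => t _; ring.
  by rewrite gmeanD gmeanD gmeanZ gmean_const; ring.
have cvar : (fun k => var_mult_rec alpha k.+1 / k.+1%:R) @ \oo --> s2.
  have -> : (fun k => var_mult_rec alpha k.+1 / k.+1%:R) =
    (fun k => gmean k (fun t => Y t ^+ 2) / k.+1%:R - (gmean k Y) ^+ 2 / k.+1%:R).
    by apply/funext => k; rewrite varE mulrBl.
  rewrite -[s2]subr0; apply: cvgB => //.
  apply: (@cvg_div_succ_of_sqrt R (fun k => gmean k Y ^+ 2) (C ^+ 2)) => j.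
  rewrite normrX; apply: le_trans (_ : C ^+ 2 <= _).
    by rewrite lerXn2r ?nnegrE // (le_trans _ (eYC 0%N)).
  by rewrite ler_peMr ?sqr_ge0 // sqrt_succ_ge1.
exists mu, s2; split.
- rewrite -cvg_shiftS /=.
  have -> : (fun n => mean_mult_rec alpha n.+1 / n.+1%:R) = (fun k => gmean k X / k.+1%:R).
    by apply/funext => k; rewrite mean_mult_recE.
  exact: cmu.
- by rewrite -cvg_shiftS.
- have [c c0 Hc] := occ_mean R (Node (Node Leaf t0) t0).
  apply: lt_le_trans c0 _; apply: (cvgr_to_ge cmu).
  exists (nvert (Node (Node Leaf t0) t0)) => // k /= kn.
  rewrite ler_pdivlMr ?ltr0n // -Hc //; apply: ler_gmean => t _.
  by rewrite ler_nat occ_le_mult.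
have [s1 [s1' [ks ks' ss ms]]] := killed_swap_pair et0.
pose D : R := (mult alpha s1)%:R - (mult alpha s1')%:R.
have D0 : 0 < D by rewrite subr_gt0 ltr_nat.
pose Z := addf (swap_weight R s1 s1').
have YD t t' : swap s1 s1' t t' -> Y t = Y t' + D.
  move=> sw; have := swap_mult ks ks' ss sw.
  move=> /(congr1 (fun n => n%:R : R)); rewrite !natrD /Y /X (swap_nvert ss sw) /D => h.
  by move: h; lra.
have [w w0 Hw] := gmean_mul_addf_swap_weight_shift ss YD.
have [q q0 Hq] := gmean_addf_swap_weight_sqr R ss.
have Dw0 : 0 < D * w by rewrite mulr_gt0.
have q1 : 0 < q + 1 by lra.
apply: lt_le_trans (_ : 0 < (D * w) ^+ 2 / (q + 1)) _.
  by rewrite divr_gt0 // exprn_gt0.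
apply: (cvgr_to_ge cvar).
exists (nvert s1) => // k /= kn; rewrite ler_pdivlMr ?ltr0n //.
(* The expanded square is minimal at [D w / q]; [q + 1] replaces [q], which is only known to be
   nonnegative. *)
pose c := D * w / (q + 1).
have : 0 <= gmean k (fun t => (Y t - gmean k Y - c * Z t) ^+ 2).
  by apply: gmean_ge0 => t _; apply: sqr_ge0.
have -> : gmean k (fun t => (Y t - gmean k Y - c * Z t) ^+ 2) =
  var_mult_rec alpha k.+1 - 2 * c * (D * w * k.+1%:R) + c ^+ 2 * (q * k.+1%:R).
  rewrite varY -Hw // -Hq // -/Z; have EZ := gmean_addf_swap_weight R ss k; rewrite -/Z in EZ.
  clearbody Y Z.
  transitivity (gmean k (fun t => (Y t - gmean k Y) ^+ 2 + (- (2 * c) * (Y t * Z t) +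
     (2 * c * gmean k Y * Z t + c ^+ 2 * Z t ^+ 2)))).
    by apply: eq_gmean => t _; ring.
  by rewrite 3!gmeanD 3!gmeanZ EZ; ring.
move=> H; have E1 : 2 * c * (D * w * k.+1%:R) - c ^+ 2 * (q * k.+1%:R) =
  (D * w) ^+ 2 / (q + 1) * k.+1%:R * (1 + (q + 1)^-1).
  by rewrite /c; field; rewrite gt_eqF.
apply: le_trans (_ : 2 * c * (D * w * k.+1%:R) - c ^+ 2 * (q * k.+1%:R) <= _); last by lra.
rewrite E1 ler_peMr //; last by rewrite lerDl invr_ge0 ltW.
by apply: mulr_ge0 => //; apply: divr_ge0; [exact: sqr_ge0 | exact: ltW].
Qed.
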